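(* Let $n\geq 1$. For any $\sigma,\sigma'\in \mathbf{S}_n^2$ one has $$\overline{B.N_\sigma}\cap\overline{B.N_{\sigma'}}=\coprod_{\substack{\varsigma\in\mathbf{S}_n^2\\ R_\varsigma\preceq R_{\sigma,\sigma'}}}B.N_\varsigma .$$ This intersection is irreducible if and only if $R_{\sigma,\sigma'}\in \mathbf{R}_n^2$.
   Context: Everything is over $\mathbb{C}$. $B$ is the group of invertible upper-triangular $n\times n$ matrices; $\mathfrak{n}=\mathfrak{n}_n$ is the space of strictly upper-triangular $n\times n$ matrices, on which $B$ acts by conjugation, $b.x:=bxb^{-1}$, and $B.x$ is the $B$-orbit of $x$. Bars denote Zariski closure. $\mathbf{S}_n$ is the symmetric group on $\{1,\dots,n\}$ and $\mathbf{S}_n^2:=\{\sigma\in\mathbf{S}_n : \sigma^2=\mathrm{id}\}$ (the identity is included). For $\sigma\in\mathbf{S}_n^2$, $N_\sigma$ is the $n\times n$ matrix with $(N_\sigma)_{i,j}=1$ if $i<j$ and $\sigma(i)=j$, and $(N_\sigma)_{i,j}=0$ otherwise. For $1\le i<j\le n$, $\pi_{i,j}:\mathfrak{n}_n\to\mathfrak{n}_{j-i+1}$ is the map deleting the first $i-1$ rows and columns and the last $n-j$ rows and columns of a matrix. The rank matrix $R_x$ of $x\in\mathfrak{n}$ is the $n\times n$ matrix with $(R_x)_{i,j}=0$ if $i\geq j$ and $(R_x)_{i,j}=\mathrm{rk}(\pi_{i,j}(x))$ if $i<j$. For $\sigma\in\mathbf{S}_n^2$ put $R_\sigma:=R_{N_\sigma}$,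 and $\mathbf{R}_n^2:=\{R_\sigma : \sigma\in\mathbf{S}_n^2\}$. For $n\times n$ matrices $A,C$ with non-negative integer entries, $A\preceq C$ means $A_{i,j}\le C_{i,j}$ for all $i,j$. For $\sigma,\sigma'\in\mathbf{S}_n^2$, $R_{\sigma,\sigma'}$ is the $n\times n$ matrix with $(R_{\sigma,\sigma'})_{i,j}:=\min\{(R_\sigma)_{i,j},(R_{\sigma'})_{i,j}\}$. *)

(* Defs.v *)
From mathcomp Require Import all_boot all_order all_fingroup all_algebra.
From mathcomp Require Import boolp classical_sets reals.
From mathcomp Require Import complex mpoly.

Set Implicit Arguments.
Unset Strict Implicit.
Unset Printing Implicit Defensive.

Import GRing.Theory.
Local Open Scope classical_set_scope.
Local Open Scope ring_scope.

Section OrbitClosures.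
Variables (F : fieldType) (n : nat).

Definition borel : set 'M[F]_n :=
  [set b | b \in unitmx /\ forall i j : 'I_n, (j < i)%N -> b i j = 0].

Definition nilradical : set 'M[F]_n :=
  [set x | forall i j : 'I_n, (j <= i)%N -> x i j = 0].

Definition borel_orbit (x : 'M[F]_n) : set 'M[F]_n :=
  [set b *m x *m invmx b | b in borel].

(* The coordinates of x : 'M_n are numbered through mxvec.  The Zariski
   topology used is that of the affine space nilradical; its polynomial
   functions are the restrictions of the polynomials in all n * n entries. *)
Definition eval_entries (p : {mpoly F[n * n]}) (x : 'M[F]_n) : F :=
  p.@[fun k => mxvec x 0 k].

Definition zariski_closed (Z : set 'M[F]_n) : Prop :=
  exists E : set {mpoly F[n * n]},
    Z = [set x | nilradical x /\ forall p, E p -> eval_entries p x = 0].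

Definition zariski_closure (A : set 'M[F]_n) : set 'M[F]_n :=
  smallest zariski_closed A.

Definition zariski_irreducible (A : set 'M[F]_n) : Prop :=
  A !=set0 /\
  forall Y Z, zariski_closed Y -> zariski_closed Z ->
    A = (A `&` Y) `|` (A `&` Z) -> A `&` Y = A \/ A `&` Z = A.

Definition involution_mx (s : 'S_n) : 'M[F]_n :=
  \matrix_(i, j) ((i < j)%N && (s i == j))%:R.

(* Rows and columns i, ..., j of x when i <= j.  The default value i of insubd
   is then never used, since i + a <= j < n for every a : 'I_(j - i).+1. *)
Definition window (i j : 'I_n) (x : 'M[F]_n) : 'M[F]_((j - i).+1) :=
  let f (a : 'I_(j - i).+1) : 'I_n := insubd i (i + a)%N in mxsub f f x.

Definition rank_mx (x : 'M[F]_n) : 'M[nat]_n :=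
  \matrix_(i, j) (if (i < j)%N then \rank (window i j x) else 0%N).

End OrbitClosures.

(* Includes the identity permutation. *)
Definition involutions (n : nat) : set 'S_n := [set s | (s * s = 1)%g].

Definition involution_rank_mx (F : fieldType) (n : nat) (s : 'S_n) :
    'M[nat]_n := rank_mx (involution_mx F s).

Definition involution_rank_mxs (F : fieldType) (n : nat) : set 'M[nat]_n :=
  [set involution_rank_mx F s | s in @involutions n].

Definition le_natmx (n : nat) (A C : 'M[nat]_n) : Prop :=
  forall i j : 'I_n, (A i j <= C i j)%N.

Definition min_rank_mx (F : fieldType) (n : nat) (s s' : 'S_n) : 'M[nat]_n :=
  \matrix_(i, j) minn (involution_rank_mx F s i j)
                      (involution_rank_mx F s' i j).

(* Main.v *)
Require Import Defs.
From mathcomp Require Import all_boot all_order all_fingroup all_algebra.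
From mathcomp Require Import boolp classical_sets reals.
From mathcomp Require Import complex mpoly.
From mathcomp Require Import zify ring.

(** Write N_s for the strictly upper-triangular matrix of an involution s, and
    call a pair q < s q an arc of s.  The proof identifies each orbit closure
    with a set cut out by ranks:

      closure (B.N_s) = { x nilpotent upper-triangular, x ^ 2 = 0, R_x <= R_s },

    which is the union of the B.N_t with R_t <= R_s.

    The right-hand side is closed (minors and the entries of x ^ 2 are
    polynomials) and contains B.N_s because rank matrices are constant on
    B-orbits.  Every square-zero x lies in some B.N_t: adding one basis vector
    at a time, a flag-adapted basis can be corrected so that x sends each of
    its vectors to 0 or to another one of them (square0_orbit).  So only one
    inclusion is deep: R_t <= R_s implies that N_t lies in closure (B.N_s).

    Since (R_s) i j counts the arcs of s contained in [i, j], this is a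
    statement on arc diagrams.  Four moves lower a diagram: delete an arc;
    push an end of an arc outwards to a fixed point; replace two nested arcs,
    or two disjoint ones, by two crossing arcs on the same four points.  Each
    move is realized by a line N_s' + u Y whose points with u <> 0 all lie in
    B.N_s, so B.N_s' is in the closure.  Conversely, if R_t <= R_s and t <> s,
    some move applied to s stays above t (exists_degeneration).  The arc to be
    moved is the one with the largest left end i on which s and t disagree.
    Points to the right of i are then arranged alike in s and t except where
    arcs start at or before i, and one looks at the region of pairs (a, b),
    a <= i, s i < b, around this arc where the count for s is strictly larger
    than the count for t.  If that region is unbounded, the arc can be deleted.
    If it is bounded in b, a point of s on its boundary provides a move with
    losses confined to the region; if it is bounded in a only, such a point
    exists to the left of i, except that one may have to make the arc (i, s i)
    cross an arc lying to its left, and then the arc with the smallest possible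
    left end is a good choice.

    The closure theorem gives the stated decomposition of the intersection I
    of two closures.  If min (R_s, R_s') is some R_u, then I is the closure
    of B.N_u, hence irreducible, B being a nonempty open subset of a linear
    space.  Conversely, for each (i, j) some N_t in I has
    (R_t) i j = min ((R_s) i j, (R_s') i j): with k this minimum, take the k
    arcs joining the first k points of [i, j] to the last k ones in order,
    which is the lowest diagram with k arcs in [i, j].  So I is contained in
    none of the finitely many closed sets where one of the ranks is smaller
    than the minimum; if I is irreducible it is not contained in their union,
    and a point outside the union lies in an orbit B.N_u with
    R_u = min (R_s, R_s'). *)

Set Implicit Arguments.
Unset Strict Implicit.
Unset Printing Implicit Defensive.

Import GRing.Theory Num.Theory.

(** * Arcs of involutions and elementary degenerations *)

(** Values of ordinals become variables before lia is called, so that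
    convertible spellings of one ordinal are a single atom. *)
Ltac ord_lia :=
  repeat match goal with
  | H : context [nat_of_ord _] |- _ => move: H
  end;
  repeat match goal with
  | |- context [@nat_of_ord ?n ?x] => move: (@nat_of_ord n x) => ?
  end; lia.

Section Arcs.
Variable n : nat.
Implicit Types (s t : 'S_n) (i j p q : 'I_n) (a b : nat).

(** Right ends are bounded strictly, so that the (i, j) entry of the rank
    matrix of s is arcs_in s i j.+1, and the bounds are natural numbers, so
    that empty windows and the bound n itself are allowed. *)
Definition arcs_in s a b : nat :=
  \sum_(q < n) [&& a <= q, q < s q & s q < b].

Lemma involutionsK s : involutions s -> involutive s.
Proof. by move=> ss x; rewrite -permM ss perm1. Qed.

Lemma involutive_involutions s : involutive s -> involutions s.
Proof. by move=> ss; apply/permP => x; rewrite permM ss perm1. Qed.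

Lemma sum_nat_pred1 i (x : bool) : \sum_(q < n) ((q == i) && x : nat) = x.
Proof. by rewrite (bigD1 i) //= eqxx big1 ?addn0 // => q /negPf ->. Qed.

Lemma arcs_in_row s q b : 
  arcs_in s q b = arcs_in s q.+1 b + (q < s q < b).
Proof.
rewrite -(sum_nat_pred1 q (q < s q < b)) -big_split /=.
by apply: eq_bigr => p _; case: (eqVneq p q) => [->|]; rewrite -?val_eqE /=; lia.
Qed.

Lemma arcs_in_col s a q : involutive s ->
  arcs_in s a q.+1 = arcs_in s a q + (a <= s q < q).
Proof.
move=> sK; rewrite -(sum_nat_pred1 (s q) (a <= s q < q)) -big_split /=.
apply: eq_bigr => p _; case: (eqVneq p (s q)) => [->|pq]; first by rewrite sK; lia.
have : s p != q by apply: contraNneq pq => <-; rewrite sK.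
rewrite -val_eqE /=; lia.
Qed.

Lemma arcs_in_cols s a b b' : involutive s -> b <= b' ->
  arcs_in s a b' = arcs_in s a b + \sum_(q < n) [&& b <= q, q < b' & a <= s q < q].
Proof.
move=> sK bb'; rewrite /arcs_in (reindex_inj (@perm_inj _ s)) /=.
rewrite [in RHS](reindex_inj (@perm_inj _ s)) /= -big_split /=.
by apply: eq_bigr => q _; rewrite sK; lia.
Qed.

Lemma arcs_in_rows s a a' b : a <= a' -> 
  arcs_in s a b = arcs_in s a' b + \sum_(q < n) [&& a <= q, q < a' & q < s q < b].
Proof. by move=> aa'; rewrite -big_split; apply: eq_bigr => q _ /=; lia. Qed.

(** The mixed second difference of the counts is a number of arcs, with both
    ends confined to a rectangle. *)
Lemma arcs_in_block s a a' b b' : a <= a' -> b <= b' ->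
  arcs_in s a b' + arcs_in s a' b = arcs_in s a' b' + arcs_in s a b +
    \sum_(q < n) [&& a <= q, q < a', b <= s q, q < s q & s q < b'].
Proof. by move=> aa' bb'; rewrite -!big_split; apply: eq_bigr => q _ /=; lia. Qed.

Lemma arcs_in_large s a b : n <= b -> arcs_in s a b = arcs_in s a n.
Proof. by move=> nb; apply: eq_bigr => q _; have := ltn_ord (s q); lia. Qed.

(** Conjugation by tperm p i performs three different moves.  If p is fixed,
    the arc (i, s i) becomes (p, s i).  If s i < s p, the nested arcs
    (p, s p) and (i, s i) become the crossing arcs (p, s i) and (i, s p).  If
    s p < p, the disjoint arcs (s p, p) and (i, s i) become the crossing arcs
    (s p, i) and (p, s i). *)
Inductive degeneration s : 'S_n -> Prop :=
| DeleteArc i : i < s i -> degeneration s (tperm i (s i) * s)%g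
| MoveLeftEnd p i : p < i -> i < s i -> (s p <= p) || (s i < s p) ->
    degeneration s (s ^ tperm p i)%g
| MoveRightEnd i (f : 'I_n) : i < s i -> s i < f -> s f = f ->
    degeneration s (s ^ tperm (s i) f)%g.

Lemma conj_tpermE s i j q :
  (s ^ tperm i j)%g q = tperm i j (s (tperm i j q)).
Proof. by rewrite /conjg tpermV !permM. Qed.

Lemma arcs_in_conj_tperm s i j a b (t := tperm i j) :
  arcs_in (s ^ t)%g a b =
    \sum_(q < n) [&& a <= t q, t q < t (s q) & t (s q) < b].
Proof.
rewrite /arcs_in (reindex_inj (@perm_inj _ t)).
by apply: eq_bigr => q _; rewrite conj_tpermE tpermK.
Qed.

(** Here and in the next lemmas, the boolean summands single out the windows in
    which the move may lose an arc. *)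
Lemma arcs_in_delete s i a b : involutive s -> i < s i ->
  arcs_in s a b <= arcs_in (tperm i (s i) * s)%g a b + ((a <= i) && (s i < b)).
Proof.
move=> sK lti; rewrite -(sum_nat_pred1 i (_ && _)) -big_split /=.
apply: leq_sum => q _; rewrite permM; case: (tpermP i (s i) q) => [->|->|].
- rewrite sK eqxx; lia.
- rewrite sK; lia.
by move=> _ _; lia.
Qed.

Lemma arcs_in_move_right s i (f : 'I_n) a b : involutive s -> i < s i -> s i < f -> s f = f ->
  arcs_in s a b <= arcs_in (s ^ tperm (s i) f)%g a b
                   + [&& a <= i, s i < b & b <= f].
Proof.
move=> sK lti ltf sf; rewrite -(sum_nat_pred1 i [&& _, _ & _]) -big_split /=.
apply: leq_sum => q _; rewrite conj_tpermE; case: (tpermP (s i) f q) => [->|->|].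
- rewrite sK; lia.
- rewrite sf; lia.
move=> /eqP qj /eqP qf; case: (eqVneq q i) => [->|qi].
  by rewrite tpermL; lia.
have hf : s q != f by apply: contraNneq qf => h; rewrite -sf -h sK.
have hj : s q != s i by rewrite (inj_eq perm_inj).
by rewrite tpermD ?(eq_sym _ (s q)) //; ord_lia.
Qed.

Lemma arcs_in_move_fixed s p i a b : involutive s ->
  p < i -> i < s i -> s p = p ->
  arcs_in s a b <= arcs_in (s ^ tperm p i)%g a b
                   + [&& p < a, a <= i & s i < b].
Proof.
move=> sK ltpi lti sp; rewrite -(sum_nat_pred1 i [&& _, _ & _]).
rewrite arcs_in_conj_tperm -big_split /=.
apply: leq_sum => q _; case: (tpermP p i q) => [->|->|].
- rewrite sp tpermL; ord_lia.
- by rewrite tpermD // -val_eqE /=; ord_lia.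
move=> /eqP qp /eqP qi.
have hp : s q != p by apply: contraNneq qp => h; rewrite -sp -h sK.
case: (eqVneq (s q) i) => [h|hi]; first by move: lti; rewrite h -h sK h; ord_lia.
by rewrite tpermD ?(eq_sym _ (s q)) //; ord_lia.
Qed.

Lemma arcs_in_move_right_end s p i a b : involutive s ->
  p < i -> i < s i -> s p < p ->
  arcs_in s a b <= arcs_in (s ^ tperm p i)%g a b
                   + [&& p < a, a <= i & s i < b] + [&& a <= s p, p < b & b <= i].
Proof.
move=> sK ltpi lti ltp.
rewrite -(sum_nat_pred1 i [&& p < a, _ & _]) -(sum_nat_pred1 (s p) [&& _, p < b & _]).
rewrite arcs_in_conj_tperm -!big_split /=.
apply: leq_sum => q _; case: (tpermP p i q) => [->|->|].
- ord_lia.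
- by rewrite eqxx tpermD // -val_eqE /=; ord_lia.
move=> /eqP qp /eqP qi.
case: (eqVneq q (s p)) => [->|hp]; first by rewrite sK tpermL; ord_lia.
case: (eqVneq (s q) i) => [h|hi]; first by move: lti; rewrite -h sK h; ord_lia.
rewrite tpermD ?(eq_sym _ (s q)) //; first ord_lia.
by apply: contraNneq hp => <-; rewrite sK.
Qed.

Lemma arcs_in_move_nested s p i a b : involutive s ->
  p < i -> i < s i -> s i < s p ->
  arcs_in s a b <= arcs_in (s ^ tperm p i)%g a b
                   + [&& p < a, a <= i, s i < b & b <= s p].
Proof.
move=> sK ltpi lti ltj.
(* In the windows with p < a <= i and s p < b, the lost arc (i, s i) is made up
   for by the new arc (i, s p). *)
suff: arcs_in s a b + [&& p < a, a <= i & s p < b] <= 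
  arcs_in (s ^ tperm p i)%g a b + [&& p < a, a <= i & s i < b] by ord_lia.
rewrite -(sum_nat_pred1 p [&& _, _ & s p < b]) -(sum_nat_pred1 i [&& _, _ & _]).
rewrite arcs_in_conj_tperm -!big_split /=.
apply: leq_sum => q _; case: (tpermP p i q) => [->|->|].
- by rewrite eqxx tpermD // -val_eqE /=; ord_lia.
- by rewrite eqxx tpermD // -val_eqE /=; ord_lia.
move=> /eqP/negPf -> /eqP/negPf ->.
case: (tpermP p i (s q)) => [h|h|_ _]; last ord_lia.
  by move: ltj; rewrite -h sK h; ord_lia.
by move: lti; rewrite -h sK h; ord_lia.
Qed.

(** The arc to be moved.  With i largest, the arcs that start after i are
    common to s and t, so the counts of row i differ by the effect of s i and
    t i alone; as t lies below s, this forces i < s i. *)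
Lemma last_difference s t : involutive s -> involutive t -> s <> t ->
  (forall a b, arcs_in t a b <= arcs_in s a b) ->
  exists i, [/\ i < s i, arcs_in t i (s i).+1 < arcs_in s i (s i).+1 &
    forall q, i < q -> (q < s q) || (q < t q) -> s q = t q].
Proof.
move=> sK tK neq le_ts.
pose P q := (s q != t q) && ((q < s q) || (q < t q)).
have [q0 Pq0] : exists q, P q.
  have [x sx] : exists x, s x != t x.
    apply/existsP; rewrite -negb_forall; apply/negP => /forallP h.
    by apply: neq; apply/permP => x; apply/eqP.
  case: (boolP ((x < s x) || (x < t x))) => [xs|]; first by exists x; apply/andP.
  have [sxx | sxx] := eqVneq (s x) x.
    exists (t x); rewrite /P tK; apply/andP; split; last first.
      by move: sx; rewrite sxx -val_eqE /=; ord_lia.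
    by apply: contraNneq sx => h; rewrite -h sK h.
  exists (s x); rewrite /P sK; apply/andP; split; last first.
    by move: sxx; rewrite -val_eqE /=; ord_lia.
  by apply: contraNneq sx => h; rewrite [X in t X]h tK.
case: (@arg_maxnP _ q0 P (fun q => nat_of_ord q) Pq0) => i /andP[neq_i lt_i] imax.
have common q : i < q -> (q < s q) || (q < t q) -> s q = t q.
  move=> ltiq hq; apply/eqP; apply: contraTT ltiq => sq; rewrite -leqNgt.
  by apply: imax; apply/andP.
have eq_next b : arcs_in s i.+1 b = arcs_in t i.+1 b.
  apply: eq_bigr => q _; case: (ltnP i q) => //= ltiq.
  case: (boolP ((q < s q) || (q < t q))) => [/(common q ltiq) -> //|]; ord_lia.
have le_i b : i < t i < b -> i < s i < b.
  move: (le_ts i b); rewrite !arcs_in_row eq_next; ord_lia.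
have lt_is : i < s i.
  case/orP: lt_i => // h; have := le_i (t i).+1; rewrite h ltnSn.
  by move=> /(_ isT) /andP[].
exists i; split=> //.
rewrite !arcs_in_row eq_next ltn_add2l lt_is ltnSn /=.
by have := le_i (t i).+1; move: neq_i; rewrite -val_eqE /=; ord_lia.
Qed.

(** The strict inequalities are required on the windows in which the three
    forms of this move may lose an arc. *)
Lemma move_left_end_above s t p i : involutive s ->
    (forall a b, arcs_in t a b <= arcs_in s a b) ->
    p < i -> i < s i -> (s p <= p) || (s i < s p) ->
    (forall a b, p < a <= i -> s i < b -> (b <= s p) || (s p <= p) ->
      arcs_in t a b < arcs_in s a b) ->
    (s p < p -> forall a b, a <= s p -> p < b <= i ->
      arcs_in t a b < arcs_in s a b) ->
  exists2 s', degeneration s s' & forall a b, arcs_in t a b <= arcs_in s' a b.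
Proof.
move=> sK le_ts ltpi lti sp ltL ltR.
exists (s ^ tperm p i)%g; first exact: MoveLeftEnd.
move=> a b; move: (le_ts a b) (ltL a b) => le_ab ltLab.
case: (ltngtP (s p) p) sp => [ltp _|ltp /= ltj|/val_inj sp _].
- have := arcs_in_move_right_end a b sK ltpi lti ltp.
  move: (ltR ltp a b) => ltRab; ord_lia.
- have := arcs_in_move_nested a b sK ltpi lti ltj; ord_lia.
- have := arcs_in_move_fixed a b sK ltpi lti sp.
  by move: ltLab; rewrite sp; ord_lia.
Qed.

(** Let b be the smallest bound at which the strict inequality fails for some
    window starting at or before i.  The last point f of that window ends an
    arc of t inside the window, but none of s.  Since arcs starting after i are common, f
    is fixed by s, or ends an arc starting before i; so the right end of
    (i, s i) can move to f, or (i, s i) can be crossed with the arc ending at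
    f.  Without any such b, the arc can be deleted. *)
Lemma exists_degeneration_unblocked s t i : involutive s -> involutive t ->
    (forall a b, arcs_in t a b <= arcs_in s a b) -> i < s i ->
    (forall q, i < q -> (q < s q) || (q < t q) -> s q = t q) ->
    (forall a, a <= i -> arcs_in t a (s i).+1 < arcs_in s a (s i).+1) ->
  exists2 s', degeneration s s' & forall a b, arcs_in t a b <= arcs_in s' a b.
Proof.
move=> sK tK le_ts lti common strict.
pose P b := (s i < b) && [exists a : 'I_i.+1, arcs_in s a b <= arcs_in t a b].
have PN b a : ~~ P b -> a <= i -> s i < b -> arcs_in t a b < arcs_in s a b.
  move=> nP ai sib; rewrite ltnNge; apply: contra nP => h.
  by rewrite /P sib; apply/existsP; exists (Ordinal (ai : a < i.+1)).
have [exP|noP] := EM (exists b, P b); last first.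
  exists (tperm i (s i) * s)%g; first exact: DeleteArc.
  move=> a b; have := arcs_in_delete a b sK lti; have := le_ts a b.
  by have /negP/PN := (fun h => noP (ex_intro _ b h)) => /(_ a); ord_lia.
case: (ex_minnP exP) => -[|b] /andP[// ltb /existsP[a lea]] bmin.
have strict' a' b' : a' <= i -> s i < b' <= b -> arcs_in t a' b' < arcs_in s a' b'.
  move=> ha /andP[hb hb']; apply: PN => //.
  by apply/negP => /bmin; rewrite ltnNge hb'.
have ai : a <= i := ltn_ord a.
have {ltb}ltb : s i < b.
  rewrite ltn_neqAle -ltnS ltb andbT; apply/eqP => h.
  by have := strict a ai; rewrite h ltnNge lea.
have ltbn : b < n.
  rewrite ltnNge; apply/negP => nb; have := strict' a b ai.
  rewrite ltb leqnn => /(_ isT).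
  by move: lea; rewrite !(@arcs_in_large _ _ b) // !(@arcs_in_large _ _ b.+1); lia.
pose f := Ordinal ltbn; rewrite -[b]/(nat_of_ord f) in ltb lea strict'.
have col : (a <= t f < f) && ~~ (a <= s f < f).
  have := strict' a f ai; rewrite ltb leqnn => /(_ isT).
  by move: lea; rewrite !arcs_in_col //; ord_lia.
case: (ltngtP (s f) f) => [ltf|ltf|/val_inj sf].
- have ltfi : s f < i.
    rewrite ltn_neqAle; apply/andP; split.
      by apply/eqP => /val_inj h; move: ltb; rewrite -h sK ltnn.
    rewrite leqNgt; apply/negP => lt; have := common _ lt; rewrite sK ltf => /(_ isT) h.
    by move: col; rewrite [X in t X]h tK; ord_lia.
  apply: (@move_left_end_above s t (s f) i) => //; rewrite ?sK.
  + by rewrite ltb orbT.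
  + by move=> a' b' ha' hb' hbf; apply: strict'; move: hbf; ord_lia.
  + by ord_lia.
- have := common f; rewrite ltf (ltn_trans lti ltb) => /(_ isT isT) h.
  by move: col; rewrite -h; ord_lia.
exists (s ^ tperm (s i) f)%g; first exact: MoveRightEnd.
move=> a' b'; have := arcs_in_move_right a' b' sK lti ltb sf.
by have := le_ts a' b'; have := strict' a' b'; ord_lia.
Qed.

(** The region of strict inequality around (i, s i) is limited by row a and by
    the bound b.  By arcs_in_block, s then has more arcs than t in the rectangle
    between the corner and (i, s i); in particular it has an arc that encloses
    (i, s i), and crossing the two loses arcs inside the region only. *)
Lemma exists_degeneration_bounded s t i a b : involutive s ->
    (forall a b, arcs_in t a b <= arcs_in s a b) -> i < s i ->
    arcs_in s a (s i).+1 <= arcs_in t a (s i).+1 ->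
    (forall a', a < a' <= i -> arcs_in t a' (s i).+1 < arcs_in s a' (s i).+1) ->
    s i < b -> (exists2 a', a < a' <= i & arcs_in s a' b <= arcs_in t a' b) ->
  exists2 s', degeneration s s' & forall a b, arcs_in t a b <= arcs_in s' a b.
Proof.
move=> sK le_ts lti le_a strict ltb exa.
pose P b := (s i < b) && [exists a' : 'I_i.+1, (a < a') && (arcs_in s a' b <= arcs_in t a' b)].
have exP : exists b, P b.
  case: exa => a' /andP[aa' a'i] le'; exists b; rewrite /P ltb.
  by apply/existsP; exists (Ordinal (a'i : a' < i.+1)); rewrite aa'.
case: (ex_minnP exP) => {exa exP ltb}b /andP[ltb /existsP[[a' /= a'i] /andP[/= aa' le']]] bmin.
have strict' a1 b1 : a < a1 <= i -> s i < b1 < b -> arcs_in t a1 b1 < arcs_in s a1 b1.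
  move=> /andP[h1 h2] /andP[hb hb']; rewrite ltnNge; apply/negP => h.
  suff /bmin : P b1 by rewrite leqNgt hb'.
  by rewrite /P hb; apply/existsP; exists (Ordinal (h2 : a1 < i.+1)); rewrite h1.
have := arcs_in_block s (ltnW aa') ltb; have := arcs_in_block t (ltnW aa') ltb.
have := strict a'; rewrite aa' -ltnS a'i => /(_ isT).
move: (le_ts a b) le' le_a; set S := \sum_(q < n) _; set T := \sum_(q < n) _.
move=> h1 h2 h3 h4 h5 h6; have {h1 h2 h3 h4 h5 h6} : T != 0 by lia.
rewrite sum_nat_eq0 negb_forall => /existsP[q]; rewrite implyTb eqb0 negbK.
move=> /and5P[aq qa' ltj ltq ltqb].
apply: (@move_left_end_above s t q i) => //; try ord_lia.
by move=> a1 b1 h1 h2 h3; apply: strict'; ord_lia.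
Qed.

(** The inequality is strict in all rows between a and i, for all bounds, but
    not at (a, (s i).+1).  If no point of [a, i) is fixed by s or starts an arc
    passing over s i, then every point of [a, i) ends an arc of s, or starts
    one that ends at s i at the latest.  Comparing the numbers of left ends
    shows that t has fewer right ends than s in every [a, x), a < x <= i.  So
    the arc of s that ends in [a, i) and starts furthest to the left can be
    crossed with (i, s i): a window [a', x) that would lose it contains all arcs
    of s ending in [a, x), hence more arcs ending there than t has. *)
Lemma exists_degeneration_unbounded s t i (a : nat) : involutive s -> involutive t ->
    (forall a b, arcs_in t a b <= arcs_in s a b) -> i < s i ->
    a < i -> arcs_in s a (s i).+1 <= arcs_in t a (s i).+1 ->
    (forall a' b, a < a' <= i -> s i < b -> arcs_in t a' b < arcs_in s a' b) ->
  exists2 s', degeneration s s' & forall a b, arcs_in t a b <= arcs_in s' a b.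
Proof.
move=> sK tK le_ts lti ai le_a strict.
have [[p] | nofree] := EM (exists p, [&& a <= p, p < i & (s p == p) || (s i < s p)]).
  case/and3P=> ap ltpi sp; apply: (@move_left_end_above s t p i) => //.
  - by case/orP: sp => [/eqP ->|->]; rewrite ?leqnn ?orbT.
  - by move=> a' b h1 h2 _; apply: strict => //; ord_lia.
  - by case/orP: sp => [/eqP ->|]; ord_lia.
have left_or_right p : a <= p -> p < i -> (s p < p) || (p < s p <= s i).
  move=> ap ltpi; apply/negPn/negP => h; apply: nofree; exists p.
  by rewrite ap ltpi -val_eqE /=; ord_lia.
(* R u x counts the right ends of u in [a, x). *)
pose R u x := \sum_(q < n) [&& a <= q, q < x & (u : 'S_n) q < q].
have ltR x : a < x <= i -> R t x < R s x.
  move=> /andP[ax xi].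
  have := strict x (s i).+1; rewrite ax xi ltnSn => /(_ isT isT).
  move: le_a; rewrite !(@arcs_in_rows _ a x) ?(ltnW ax) //.
  pose L u := \sum_(q < n) [&& a <= q, q < x & q < (u : 'S_n) q < (s i).+1].
  rewrite -!/(L _).
  have : L s + R s x = \sum_(q < n) (a <= q < x).
    rewrite -big_split; apply: eq_bigr => q _ /=.
    by move: (left_or_right q); ord_lia.
  have : L t + R t x <= \sum_(q < n) (a <= q < x).
    by rewrite -big_split; apply: leq_sum => q _ /=; ord_lia.
  lia.
pose P q := [&& a <= q, q < i & s q < q].
have [p0 Pp0] : exists p, P p.
  have := ltR a.+1; rewrite ltnSn ai => /(_ isT) h.
  have {h}: R s a.+1 != 0 by lia.
  rewrite sum_nat_eq0 negb_forall => /existsP[q]; rewrite implyTb eqb0 negbK.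
  by move=> /and3P[h1 h2 h3]; exists q; rewrite /P; ord_lia.
case: (@arg_minnP _ p0 P (fun q => nat_of_ord (s q)) Pp0) => p /and3P[ap ltpi ltp] pmin.
apply: (@move_left_end_above s t p i) => //; first by rewrite ltnW.
  by move=> a' b h1 h2 _; apply: strict => //; ord_lia.
move=> _ a' b ha /andP[pb bi].
have ab : a <= b by lia.
rewrite !(@arcs_in_cols _ a' a b) //.
apply: (@leq_trans (arcs_in t a' a + R s b)).
  rewrite -addnS leq_add2l; apply: leq_ltn_trans (ltR b _); last by ord_lia.
  by apply: leq_sum => q _; ord_lia.
apply: leq_add => //; apply: leq_sum => q _.
by move: (pmin q); rewrite /P; ord_lia.
Qed.

Lemma exists_degeneration s t : involutive s -> involutive t -> s <> t ->
    (forall a b, arcs_in t a b <= arcs_in s a b) ->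
  exists2 s', degeneration s s' & forall a b, arcs_in t a b <= arcs_in s' a b.
Proof.
move=> sK tK neq le_ts.
have [i [lti lt_i common]] := last_difference sK tK neq le_ts.
pose tight (x : 'I_i.+1) := arcs_in s x (s i).+1 <= arcs_in t x (s i).+1.
have [[a0 ta0]|notight] := EM (exists x, tight x); last first.
  apply: (exists_degeneration_unblocked sK tK le_ts lti common) => a ai.
  rewrite ltnNge; apply/negP => h; apply: notight.
  by exists (Ordinal (ai : a < i.+1)).
case: (@arg_maxnP _ a0 tight (fun x => nat_of_ord x) ta0) => -[a /= ai] ta amax.
have ltai : a < i.
  rewrite ltn_neqAle -ltnS ai andbT; apply/eqP => h.
  by move: lt_i ta; rewrite /tight /= -h ltnNge => /negPf ->.
have strict a' : a < a' <= i -> arcs_in t a' (s i).+1 < arcs_in s a' (s i).+1.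
  move=> /andP[aa' a'i]; rewrite ltnNge; apply/negP => h.
  by have := amax (Ordinal (a'i : a' < i.+1)) h; rewrite leqNgt aa'.
have [[b [ltb exa]]|nob] := EM (exists b, s i < b /\ 
    exists2 a', a < a' <= i & arcs_in s a' b <= arcs_in t a' b).
  exact: (exists_degeneration_bounded sK le_ts lti ta strict ltb exa).
apply: (exists_degeneration_unbounded sK tK le_ts lti ltai ta) => a' b ha hb.
by rewrite ltnNge; apply/negP => h; apply: nob; exists b; split=> //; exists a'.
Qed.

Lemma arcs_in_inj s t : involutive s -> involutive t ->
  (forall a b, arcs_in s a b = arcs_in t a b) -> s = t.
Proof.
move=> sK tK eq_st; have [//|neq] := EM (s = t).
have [|i [_]] := last_difference sK tK neq; first by move=> a b; rewrite eq_st.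
by rewrite eq_st ltnn.
Qed.

Lemma degeneration_neq s s' : involutive s -> degeneration s s' -> s' <> s.
Proof.
move=> sK; case=> [i lti|p i ltpi lti sp|i f lti ltf sf] /permP.
- by move/(_ i); rewrite permM tpermL; move=> /perm_inj h; move: lti; rewrite h ltnn.
- move/(_ p); rewrite conj_tpermE tpermL tpermD -?val_eqE /=; try ord_lia.
  by move=> h; move: sp; rewrite -h; ord_lia.
move/(_ f); rewrite conj_tpermE tpermR sK sf tpermD -?val_eqE /=; try ord_lia.
by move=> h; move: lti ltf; rewrite -h; ord_lia.
Qed.

Lemma degeneration_involutive s s' : involutive s -> degeneration s s' -> involutive s'.
Proof.
move=> sK; have ss := involutive_involutions sK.
have conjK t : involutive (s ^ t)%g.
  by apply: involutionsK; rewrite /involutions /= -conjMg ss conj1g.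
case=> [i lti|p i _ _ _|i f _ _ _] //= x; rewrite !permM.
case: (tpermP i (s i) x) => [->|->|].
- by rewrite sK tpermL sK.
- by rewrite tpermR.
move=> /eqP xi /eqP xsi; rewrite tpermD ?sK //.
  by apply: contraNneq xsi => ->; rewrite sK.
by rewrite (inj_eq perm_inj) eq_sym.
Qed.

Lemma sum_interval (m lo hi : nat) :
  \sum_(q < m) (lo <= q < hi : nat) = minn hi m - lo.
Proof.
elim: m => [|m IHm]; first by rewrite big_ord0; lia.
by rewrite big_ord_recr /= IHm; lia.
Qed.

(** The two ends of an arc are distinct, and no point is an end of two arcs. *)
Lemma arcs_in_double s a b : involutive s -> (arcs_in s a b).*2 <= b - a.
Proof.
move=> sK; rewrite -addnn [X in X + _](reindex_inj (@perm_inj _ s)) /= -big_split /=.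
apply: leq_trans (_ : \sum_(q < n) (a <= q < b : nat) <= _); last first.
  by rewrite sum_interval; lia.
by apply: leq_sum => q _; rewrite sK; ord_lia.
Qed.

(** A point removed from a window destroys at most one arc. *)
Lemma arcs_in_shrink s a a' b b' : involutive s ->
  arcs_in s a b <= arcs_in s a' b' + (a' - a) + (b - b').
Proof.
move=> sK.
have h1 : arcs_in s a b <= arcs_in s a' b + (a' - a).
  case: (leqP a a') => h; last first.
    by apply: leq_trans (leq_addr _ _); apply: leq_sum => q _; ord_lia.
  rewrite (arcs_in_rows _ _ h) leq_add2l.
  apply: leq_trans (_ : \sum_(q < n) (a <= q < a' : nat) <= _).
    by apply: leq_sum => q _; ord_lia.
  by rewrite sum_interval; lia.
have h2 : arcs_in s a' b <= arcs_in s a' b' + (b - b').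
  case: (leqP b' b) => h; last first.
    by apply: leq_trans (leq_addr _ _); apply: leq_sum => q _; ord_lia.
  rewrite (arcs_in_cols _ sK h) leq_add2l.
  apply: leq_trans (_ : \sum_(q < n) (b' <= q < b : nat) <= _).
    by apply: leq_sum => q _; ord_lia.
  by rewrite sum_interval; lia.
lia.
Qed.

(** The arcs join the first k points of the window to the last k ones in order,
    so every point removed on either side costs one arc: by arcs_in_shrink no
    involution with k arcs in this window has smaller counts. *)
Lemma exists_spread_arcs (i j k : nat) : j <= n -> k.*2 <= j - i ->
  exists t, [/\ involutive t, k <= arcs_in t i j &
    forall a b, (arcs_in t a b == 0) || (arcs_in t a b + (a - i) + (j - b) <= k)].
Proof.
move=> jn kij; have [d kd dj] : exists2 d, k <= d & (k == 0) || (i + d + k == j).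
  by exists (j - k - i); lia.
pose f (x : nat) := if i <= x < i + k then x + d else
                    if i + d <= x < i + d + k then x - d else x.
have ltf (x : 'I_n) : f x < n by have := ltn_ord x; rewrite /f; do 2?[case: ifP => ?]; ord_lia.
have fK (x : nat) : f (f x) = x.
  rewrite [X in f X]/f; case: ifP => ?; [|case: ifP => ?];
    rewrite /f; do 2?[case: ifP => ?]; lia.
pose g x := Ordinal (ltf x).
have gK : involutive g by move=> x; apply: val_inj; rewrite /= fK.
pose t := perm (inv_inj gK).
have tE q : t q = f q :> nat by rewrite permE.
exists t; split.
- by move=> x; rewrite !permE gK.
- rewrite -[X in X <= _](_ : \sum_(q < n) (i <= q < i + k : nat) = k); last first.
    by rewrite sum_interval; lia.
  by apply: leq_sum => q _; rewrite tE /f; do 2?[case: ifP => ?]; ord_lia.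
move=> a b; have := sum_interval n (maxn a i) (i + k - (j - b)).
rewrite (_ : \sum_(q < n) _ = arcs_in t a b); first by move=> ->; lia.
apply: eq_bigr => q _; congr nat_of_bool.
by rewrite tE /f; do 2?[case: ifP => ?]; ord_lia.
Qed.
End Arcs.

Local Open Scope classical_set_scope.
Local Open Scope ring_scope.

(** * The Borel group, its orbits, and windows *)

Section Borel.
Variables (F : fieldType) (n : nat).
Implicit Types (b x y : 'M[F]_n).

Definition upper_triangular x := forall i j : 'I_n, (j < i)%N -> x i j = 0.

Lemma upper_triangular_det x : upper_triangular x -> \det x = \prod_i x i i.
Proof.
move=> xu; rewrite -det_tr det_trig.
  by apply: eq_bigr => i _; rewrite mxE.
by apply/is_trig_mxP => i j ij; rewrite mxE xu.
Qed.

Lemma borelP b : borel b <-> upper_triangular b /\ forall i, b i i != 0.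
Proof.
split=> [[bU bu]|[bu bd]]; split=> //.
  move: bU; rewrite unitmxE upper_triangular_det // unitfE => /prodf_neq0 h i.
  exact: h.
by rewrite unitmxE upper_triangular_det // unitfE; apply/prodf_neq0 => i _.
Qed.

Lemma upper_triangularM x y :
  upper_triangular x -> upper_triangular y -> upper_triangular (x *m y).
Proof.
move=> xu yu i j ij; rewrite mxE big1 // => k _.
case: (ltnP k i) => ki; first by rewrite xu // mul0r.
by rewrite yu ?mulr0 // (leq_trans ij).
Qed.

Lemma borel1 : borel (1%:M : 'M[F]_n).
Proof.
split=> [|i j ij]; first exact: unitmx1.
by rewrite mxE (_ : i == j = false) // -val_eqE /= gtn_eqF.
Qed.

Lemma borelM b c : borel b -> borel c -> borel (b *m c).
Proof.
move=> [bU bu] [cU cu]; split; first by rewrite unitmx_mul bU.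
exact: upper_triangularM.
Qed.

(** The entries of b *m invmx b = 1 below the diagonal show, from the last row
    upwards, that those of invmx b vanish. *)
Lemma borelV b : borel b -> borel (invmx b).
Proof.
move=> bB; have [bU _] := bB; have /borelP[bu bd] := bB.
split=> [|i j]; first by rewrite unitmx_inv.
have [m] := ubnP (n - i)%N; elim: m i => // m IHm i; rewrite ltnS => mi ji.
have /matrixP/(_ i j) := mulmxV bU.
rewrite !mxE (bigD1 i) //= big1 => [|k ki].
  rewrite addr0 (_ : i == j = false); last by rewrite -val_eqE /= gtn_eqF.
  by move/eqP; rewrite mulf_eq0 (negPf (bd i)) => /eqP.
case: (ltnP k i) => [lt|le]; first by rewrite bu // mul0r.
have ik : (i < k)%N by rewrite ltn_neqAle le andbT eq_sym.
rewrite (IHm k) ?mulr0 ?(ltn_trans ji) //.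
by have := ltn_ord k; lia.
Qed.

Lemma borel_orbitI b x y : borel b -> b *m x = y *m b -> borel_orbit x y.
Proof.
move=> bB xy; exists b => //; rewrite xy -mulmxA mulmxV ?mulmx1 //.
by case: bB.
Qed.

Lemma borel_orbit_refl x : borel_orbit x x.
Proof. by apply: (borel_orbitI borel1); rewrite mul1mx mulmx1. Qed.

Lemma borel_orbit_sym x y : borel_orbit x y -> borel_orbit y x.
Proof.
move=> [b bB <-]; have [bU _] := bB; apply: (borel_orbitI (borelV bB)).
by rewrite !mulmxA mulVmx // mul1mx.
Qed.

Lemma borel_orbit_trans x y z : borel_orbit x y -> borel_orbit y z -> borel_orbit x z.
Proof.
move=> [b bB <-] [c cB <-]; have [bU _] := bB; have [cU _] := cB.
apply: (borel_orbitI (borelM cB bB)).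
by rewrite -!mulmxA (mulmxA (invmx c)) mulVmx // mul1mx mulVmx ?mulmx1.
Qed.

Lemma nilradical_upper x : nilradical x -> upper_triangular x.
Proof. by move=> xn i j ij; apply: xn; apply: ltnW. Qed.

Lemma nilradicalMl b x : upper_triangular b -> nilradical x -> nilradical (b *m x).
Proof.
move=> bu xn i j ji; rewrite mxE big1 // => k _.
case: (ltnP k i) => ki; first by rewrite bu // mul0r.
by rewrite xn ?mulr0 // (leq_trans ji).
Qed.

Lemma nilradicalMr b x : upper_triangular b -> nilradical x -> nilradical (x *m b).
Proof.
move=> bu xn i j ji; rewrite mxE big1 // => k _.
case: (leqP k i) => ki; first by rewrite xn // mul0r.
by rewrite bu ?mulr0 // (leq_ltn_trans ji).
Qed.

Lemma borel_orbit_nilradical x y : nilradical x -> borel_orbit x y -> nilradical y.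
Proof.
move=> xn [b bB <-]; have [_ bVu] := borelV bB; have [_ bu] := bB.
exact/nilradicalMr/nilradicalMl.
Qed.

Lemma borel_orbit_square0 x y : x *m x = 0 -> borel_orbit x y -> y *m y = 0.
Proof.
move=> xx [b [bU _] <-].
by rewrite -!mulmxA (mulmxA (invmx b) b) mulVmx // mul1mx (mulmxA x x) xx mul0mx mulmx0.
Qed.

Lemma window_index (i j : 'I_n) (ij : (i <= j)%N) (a : 'I_(j - i).+1) :
  nat_of_ord (insubd i (i + a)%N) = (i + a)%N.
Proof. by rewrite val_insubd; case: ifP => //; have := ltn_ord a; have := ltn_ord j; lia. Qed.

Lemma big_window (V : Type) (idx : V) (op : Monoid.com_law idx)
    (i j : 'I_n) (G : 'I_n -> V) : (i <= j)%N ->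
  (forall k : 'I_n, ~~ (i <= k <= j)%N -> G k = idx) ->
  \big[op/idx]_k G k = \big[op/idx]_(a < (j - i).+1) G (insubd i (i + a)%N).
Proof.
move=> ij G0; rewrite (bigID (fun k : 'I_n => (i <= k <= j)%N)) /=.
rewrite [X in op _ X]big1 // Monoid.mulm1.
rewrite (reindex_onto (fun a : 'I_(j - i).+1 => insubd i (i + a)%N)
   (fun k : 'I_n => inord (k - i)%N)) /=; last first.
  move=> k ijk; apply: val_inj; rewrite val_insubd inordK; last lia.
  by rewrite subnKC ?ltn_ord //; lia.
apply: eq_bigl => a; rewrite window_index //.
have la := ltn_ord a; rewrite (_ : (i <= i + a <= j)%N = true); last lia.
by apply/eqP/val_inj; rewrite /= inordK; lia.
Qed.

(** An entry of x *m y with indices in [i, j] only involves intermediate indices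
    in [i, j] when x and y are upper triangular. *)
Lemma windowM (i j : 'I_n) x y : (i <= j)%N ->
  upper_triangular x -> upper_triangular y ->
  window i j (x *m y) = window i j x *m window i j y.
Proof.
move=> ij xu yu; apply/matrixP => a b; rewrite !mxE.
rewrite (big_window _ ij) => [|k].
  by apply: eq_bigr => c _; rewrite !mxE.
have := window_index ij a; have := window_index ij b.
have := ltn_ord a; have := ltn_ord b; set u := insubd _ _; set v := insubd _ _ => *.
have [ki|ik] := ltnP k v; first by rewrite xu // mul0r.
by rewrite (yu k u) ?mulr0 //; lia.
Qed.

Lemma window1 (i j : 'I_n) : (i <= j)%N -> window i j (1%:M : 'M[F]_n) = 1%:M.
Proof.
move=> ij; apply/matrixP => a b; rewrite !mxE -val_eqE /= !window_index //.
by rewrite eqn_add2l val_eqE.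
Qed.

Lemma rank_mx_orbit x y : upper_triangular x -> borel_orbit x y -> rank_mx y = rank_mx x.
Proof.
move=> xu [b bB <-]; have [bU bu] := bB; have [_ bVu] := borelV bB.
apply/matrixP => i j; rewrite !mxE; case: ifP => // /ltnW ij.
have bxu := upper_triangularM bu xu.
rewrite !windowM //.
have wb : window i j b \in unitmx.
  by case: (mulmx1_unit (_ : window i j b *m window i j (invmx b) = 1%:M)) => //;
    rewrite -windowM // mulmxV // window1.
have wbV : window i j (invmx b) \in unitmx.
  by case: (mulmx1_unit (_ : window i j (invmx b) *m window i j b = 1%:M)) => //;
    rewrite -windowM // mulVmx // window1.
rewrite mxrankMfree ?row_free_unit //.
by rewrite -mxrank_tr trmx_mul mxrankMfree ?mxrank_tr // row_free_unit unitmx_tr.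
Qed.
End Borel.

(** * Rank matrices of involutions *)

Section RankInvolution.
Variables (F : fieldType) (n : nat).

(** M factors through the space with basis P, as a matrix with orthonormal
    columns times a matrix with orthonormal rows. *)
Lemma rank_partial_injection (m p : nat) (P : pred 'I_m) (h : 'I_m -> 'I_p)
    (M : 'M[F]_(m, p)) :
  {in P &, injective h} -> (forall a b, M a b = (P a && (h a == b))%:R) ->
  \rank M = #|P|.
Proof.
move=> h_inj ME; set k := #|P|.
pose A := \matrix_(a < m, c < k) (enum_val c == a)%:R : 'M[F]_(m, k).
pose C := \matrix_(c < k, b < p) (h (enum_val c) == b)%:R : 'M[F]_(k, p).
have MAC : M = A *m C.
  apply/matrixP => a b; rewrite ME mxE.
  case: (boolP (a \in P)) => Pa.
    rewrite (bigD1 (enum_rank_in Pa a)) //= big1 ?addr0 => [|c nca].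
      by rewrite !mxE enum_rankK_in // eqxx mul1r; move: Pa; rewrite unfold_in => ->.
    rewrite !mxE (_ : enum_val c == a = false) ?mul0r //.
    by apply: contraNF nca => /eqP ca; rewrite -[c](enum_valK_in Pa) ca.
  rewrite big1 => [|c _]; first by move: Pa; rewrite unfold_in => /negPf ->.
  rewrite !mxE (_ : enum_val c == a = false) ?mul0r //.
  by apply: contraNF Pa => /eqP <-; apply: enum_valP.
have AA : A^T *m A = 1%:M.
  apply/matrixP => c d; rewrite !mxE (bigD1 (enum_val c)) //= big1 ?addr0 => [|a nac].
    by rewrite !mxE eqxx mul1r (inj_eq enum_val_inj) eq_sym.
  by rewrite !mxE eq_sym (negPf nac) mul0r.
have CC : C *m C^T = 1%:M.
  apply/matrixP => c d; rewrite !mxE (bigD1 (h (enum_val c))) //= big1 ?addr0 => [|b nbc].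
    rewrite !mxE eqxx mul1r (inj_in_eq h_inj) ?enum_valP //.
    by rewrite (inj_eq enum_val_inj) eq_sym.
  by rewrite !mxE eq_sym (negPf nbc) mul0r.
apply/eqP; rewrite eqn_leq; apply/andP; split.
  by rewrite MAC (leq_trans (mxrankM_maxl _ _)) ?rank_leq_col.
have : A^T *m M *m C^T = 1%:M by rewrite MAC !mulmxA AA mul1mx CC.
move/(congr1 mxrank); rewrite mxrank1 => <-.
by rewrite (leq_trans (mxrankM_maxl _ _)) ?mxrankM_maxr.
Qed.

Lemma rank_involution_mx (s : 'S_n) (i j : 'I_n) :
  involution_rank_mx F s i j = arcs_in s i j.+1.
Proof.
rewrite /involution_rank_mx mxE; case: ifP => [ij|/negbT nij]; last first.
  by rewrite /arcs_in big1 // => q _; move: nij; ord_lia.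
have leij := ltnW ij.
pose f (a : 'I_(j - i).+1) : 'I_n := insubd i (i + a)%N.
have fE a : f a = (i + a)%N :> nat by rewrite /f window_index.
pose P (a : 'I_(j - i).+1) := (f a < s (f a) <= j)%N.
pose h (a : 'I_(j - i).+1) : 'I_(j - i).+1 := inord (s (f a) - i).
have hE a : P a -> (i + h a)%N = s (f a).
  by move=> /andP[h1 h2]; rewrite inordK; move: (fE a); ord_lia.
rewrite (@rank_partial_injection _ _ P h); first last.
- move=> a b; rewrite !mxE -/(f a) -/(f b); congr (nat_of_bool _)%:R.
  case: (boolP (P a)) => Pa /=.
    rewrite -[in RHS]val_eqE /= -(eqn_add2l i) hE // -fE -val_eqE /=.
    by case: eqP => h'; rewrite ?andbF // andbT -h'; case/andP: Pa.
  apply/negbTE; apply: contraNN Pa => /andP[h1 /eqP h2].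
  by rewrite /P h2 h1; have := ltn_ord b; rewrite fE; lia.
- move=> a b Pa Pb hab; apply: val_inj; have := hE a Pa; rewrite hab hE //.
  by move=> /val_inj/perm_inj/(congr1 (@nat_of_ord n)); rewrite !fE => /addnI.
rewrite /arcs_in (big_window _ leij) => [|k]; last by ord_lia.
rewrite -sum1_card big_mkcond /=; apply: eq_bigr => a _.
rewrite -/(f a) unfold_in /P ltnS fE leq_addr /=.
by case: ifP.
Qed.

Lemma involution_rank_mx_le (s t : 'S_n) :
  involutive s -> involutive t ->
  le_natmx (involution_rank_mx F t) (involution_rank_mx F s) <->
  forall a b, (arcs_in t a b <= arcs_in s a b)%N.
Proof.
move=> sK tK; split=> [le_ts a b|le_ts i j]; last first.
  by rewrite !rank_involution_mx.
have [na|an] := leqP n a.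
  rewrite [X in (X <= _)%N]big1 // => q _; have := ltn_ord q; ord_lia.
wlog bn : b / (b <= n)%N => [hw|].
  have [/hw //|/ltnW nb] := leqP b n.
  by rewrite !(@arcs_in_large _ _ _ b) //; apply: hw.
case: b bn => [_|b bn].
  rewrite [X in (X <= _)%N]big1 // => q _; ord_lia.
by have := le_ts (Ordinal an) (Ordinal bn); rewrite !rank_involution_mx.
Qed.

Lemma involution_rank_mx_inj (s t : 'S_n) : involutive s -> involutive t ->
  involution_rank_mx F s = involution_rank_mx F t -> s = t.
Proof.
move=> sK tK eq_st; apply: arcs_in_inj => // a b; apply/eqP.
have le_st : le_natmx (involution_rank_mx F s) (involution_rank_mx F t).
  by move=> i j; rewrite eq_st.
have le_ts : le_natmx (involution_rank_mx F t) (involution_rank_mx F s).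
  by move=> i j; rewrite eq_st.
rewrite eqn_leq; apply/andP; split.
  by move/involution_rank_mx_le: le_st; apply.
by move/involution_rank_mx_le: le_ts; apply.
Qed.

Lemma nilradical_involution_mx (s : 'S_n) : nilradical (involution_mx F s).
Proof. by move=> i j ji; rewrite mxE ltnNge ji. Qed.

Lemma involution_mx_square0 (s : 'S_n) : involutive s ->
  involution_mx F s *m involution_mx F s = 0.
Proof.
move=> sK; apply/matrixP => i j; rewrite !mxE big1 // => k _; rewrite !mxE.
case: (altP (s i =P k)) => [<-|]; last by rewrite andbF mul0r.
case: (altP (s (s i) =P j)) => [|]; last by rewrite !andbF mulr0.
rewrite sK => <-; case: ltnP => h; last by rewrite mul0r.
by rewrite (ltnNge _ i) (ltnW h) /= mulr0.
Qed.
End RankInvolution.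

(** * Square-zero orbits have involutions as representatives *)

Section Classification.
Variables (F : fieldType) (n : nat).
Implicit Types (x g : 'M[F]_n) (s : 'S_n).

Lemma involution_mx_col s (c : 'I_n) : involutive s ->
  involution_mx F s *m delta_mx c (0 : 'I_1) =
    (if (s c < c)%N then delta_mx (s c) 0 else 0) :> 'cV_n.
Proof.
move=> sK; rewrite -colE; apply/matrixP => i j; rewrite !mxE ord1.
have [<-|sic] := eqVneq (s i) c; first by rewrite sK !andbT; case: ifP; rewrite mxE ?eqxx.
rewrite andbF; case: ifP; rewrite mxE // andbT => _.
by case: eqP => // ic; case/eqP: sic; rewrite ic sK.
Qed.

Lemma borel_conj_cols g x s (k : nat) : borel g ->
  (forall c : 'I_n, (c < k)%N ->
     x *m g *m delta_mx c (0 : 'I_1) = g *m involution_mx F s *m delta_mx c 0) ->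
  forall i c : 'I_n, (c < k)%N -> (invmx g *m x *m g) i c = involution_mx F s i c.
Proof.
move=> [gU _] cols i c ck.
have /matrixP/(_ i 0) : col c (invmx g *m x *m g) = col c (involution_mx F s).
  by rewrite !colE -!mulmxA (mulmxA x) cols // !mulmxA mulVmx // mul1mx.
by rewrite !mxE.
Qed.

(** One step of the construction of an adapted basis: x has been brought to the
    form N_s in the columns before K, and column K is to be treated next. *)
Section Step.
Variables (x : 'M[F]_n) (s : 'S_n) (K : 'I_n).
Hypotheses (xn : nilradical x) (xx : x *m x = 0) (sK : involutive s).
Hypothesis s_fix : forall q : 'I_n, (K <= q)%N -> s q = q.
Hypothesis x_cols : forall i c : 'I_n, (c < K)%N -> x i c = involution_mx F s i c.

Let right_lt q : (s q < q)%N -> (q < K)%N.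
Proof. by move=> h; rewrite ltnNge; apply/negP => /s_fix h'; rewrite h' ltnn in h. Qed.

(** Only left ends and fixed points of s contribute to column K of x.  The
    contribution of a left end is the image of the basis vector of the
    corresponding right end; correction collects these, and fixed_part is what
    cannot be removed in this way. *)
Let fixed_part : 'cV[F]_n := \col_i (if (s i == i) && (i < K)%N then x i K else 0).
Let correction : 'cV[F]_n := \col_i (if (s i < i)%N then x (s i) K else 0).

Let column_right q : (s q < q)%N -> x q K = 0.
Proof.
move=> sq; have qK := right_lt sq.
have /matrixP/(_ (s q) K) := xx; rewrite !mxE (bigD1 q) //= big1 => [|d dq].
  by rewrite addr0 x_cols // mxE sq sK eqxx mul1r.
have [dK|Kd] := ltnP d K; last by rewrite (xn Kd) mulr0.
by rewrite x_cols // mxE sK eq_sym (negPf dq) andbF mul0r.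
Qed.

Let mul_correction : x *m correction = col K x - fixed_part.
Proof.
apply/matrixP => i j; rewrite !mxE.
have xid d : x i d * correction d j = ((i < d)%N && (d == s i))%:R * x i K.
  rewrite mxE; case: ifP => sd; last first.
    rewrite mulr0; have [ds|_] := eqVneq d (s i); last by rewrite andbF mul0r.
    by move: sd; rewrite ds sK => ->; rewrite mul0r.
  rewrite x_cols ?right_lt // mxE eq_sym.
  by have [->|] := eqVneq d (s i); rewrite ?andbF ?mul0r ?sK.
under eq_bigr => d _ do rewrite xid.
rewrite -mulr_suml (bigD1 (s i)) //= eqxx andbT big1 ?addr0; last first.
  by move=> d /negPf ->; rewrite andbF.
case: (ltngtP i (s i)) => [lt|gt|/val_inj <-] /=.
- by rewrite -val_eqE /= gtn_eqF //= subr0 mul1r.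
- by rewrite -val_eqE /= ltn_eqF //= subr0 column_right ?mulr0.
rewrite eqxx mul0r /=; case: ltnP => iK; first by rewrite subrr.
by rewrite subr0 (xn iK).
Qed.

Let mul_fixed_part : x *m fixed_part = 0.
Proof.
apply/matrixP => i j; rewrite !mxE big1 // => d _; rewrite mxE.
case: ifP => [/andP[/eqP sd dK]|_]; last by rewrite mulr0.
rewrite (x_cols i dK) mxE; case: eqP => sid; last by rewrite andbF mul0r.
by rewrite -sd -sid sK ltnn mul0r.
Qed.

Let x_e_lt (c : 'I_n) : (c < K)%N ->
  x *m delta_mx c (0 : 'I_1) = involution_mx F s *m delta_mx c 0.
Proof. by move=> cK; rewrite -!colE; apply/matrixP => i j; rewrite !mxE x_cols // mxE. Qed.

Lemma exists_extended_column : exists g s',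
  [/\ borel g, involutive s', forall q : 'I_n, (K < q)%N -> s' q = q &
    forall c : 'I_n, (c < K.+1)%N ->
     x *m g *m delta_mx c (0 : 'I_1) = g *m involution_mx F s' *m delta_mx c 0].
Proof.
have corr_ge (i : 'I_n) : (K <= i)%N -> correction i 0 = 0.
  by move=> Ki; rewrite mxE (s_fix Ki) ltnn.
pose P i := (s i == i) && (i < K)%N && (x i K != 0).
have [[a0 Pa0]|noP] := EM (exists a, P a); last first.
  (* The corrected basis vector K is killed by x, and K remains fixed. *)
  pose g := \matrix_(i, j) ((i == j)%:R - (if j == K then correction i 0 else 0)).
  have g_e c : c != K -> g *m delta_mx c (0 : 'I_1) = delta_mx c 0.
    move=> cK; rewrite -colE; apply/matrixP => i j.
    by rewrite !mxE (negPf cK) subr0 ord1 eqxx andbT.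
  have g_K : g *m delta_mx K (0 : 'I_1) = delta_mx K 0 - correction.
    by rewrite -colE; apply/matrixP => i j; rewrite !mxE eqxx ord1 eqxx andbT.
  have w0 : fixed_part = 0.
    apply/matrixP => i j; rewrite !mxE; case: ifP => // h; apply/eqP.
    by apply/negPn/negP => h'; apply: noP; exists i; rewrite /P h.
  exists g, s; split=> //.
  - apply/borelP; split=> [i j ji|i]; rewrite mxE.
      rewrite -val_eqE /= gtn_eqF // sub0r; case: (eqVneq j K) => [jK|_]; last by rewrite oppr0.
      by rewrite corr_ge ?oppr0 // -jK ltnW.
    rewrite eqxx; case: (eqVneq i K) => [->|_]; last by rewrite subr0 oner_eq0.
    by rewrite corr_ge // subr0 oner_eq0.
  - by move=> q /ltnW; apply: s_fix.
  move=> c; rewrite ltnS leq_eqVlt => /orP[/eqP/val_inj ->|cK].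
    rewrite -!mulmxA g_K mulmxBr mul_correction w0 subr0 -(colE K x) subrr.
    by rewrite involution_mx_col // s_fix // ltnn mulmx0.
  have neqK (d : 'I_n) : (d < K)%N -> d != K by rewrite -val_eqE => /ltn_eqF/negbT.
  rewrite -!mulmxA g_e ?neqK // x_e_lt // !involution_mx_col //.
  by case: ifP => sc; rewrite ?mulmx0 // g_e ?neqK ?(ltn_trans sc).
case: (@arg_maxnP _ a0 P (fun a => nat_of_ord a) Pa0) => a /andP[/andP[/eqP sa aK] xaK] amax.
(* The basis vector a is replaced by the image of the corrected basis vector K.
   As a is the last fixed point involved in this image, the change of basis is
   upper triangular. *)
have neq_aK : a != K by rewrite -val_eqE /= ltn_eqF.
pose s' := (tperm a K * s)%g.
have s'a : s' a = K by rewrite permM tpermL s_fix.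
have s'K : s' K = a by rewrite permM tpermR sa.
have s'E c : c != a -> c != K -> s' c = s c.
  by move=> ca cK; rewrite permM tpermD // eq_sym.
have s'inv : involutive s'.
  move=> c; have [->|ca] := eqVneq c a; first by rewrite s'a s'K.
  have [->|cK] := eqVneq c K; first by rewrite s'K s'a.
  rewrite (s'E c) // s'E ?sK //.
    by apply: contraNneq ca => h; rewrite -[c]sK h sa.
  by apply: contraNneq cK => h; rewrite -[c]sK h s_fix.
pose g := \matrix_(i, j) (if j == K then (i == K)%:R - correction i 0
            else if j == a then fixed_part i 0 else (i == j)%:R).
have g_e c : c != K -> c != a -> g *m delta_mx c (0 : 'I_1) = delta_mx c 0.
  move=> cK ca; rewrite -colE; apply/matrixP => i j.
  by rewrite !mxE (negPf cK) (negPf ca) ord1 eqxx andbT.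
have g_K : g *m delta_mx K (0 : 'I_1) = delta_mx K 0 - correction.
  by rewrite -colE; apply/matrixP => i j; rewrite !mxE eqxx ord1 eqxx andbT.
have g_a : g *m delta_mx a (0 : 'I_1) = fixed_part.
  by rewrite -colE; apply/matrixP => i j; rewrite !mxE (negPf neq_aK) eqxx.
exists g, s'; split=> //.
- apply/borelP; split=> [i j ji|i]; rewrite mxE.
    case: (eqVneq j K) => [jK|_].
      by rewrite corr_ge ?subr0 -?jK ?(ltnW ji) // -val_eqE /= gtn_eqF.
    case: (eqVneq j a) => [ja|_]; last by rewrite -val_eqE /= gtn_eqF.
    rewrite mxE; case: ifP => // h; apply/eqP/negPn/negP => h'.
    by have := amax i; rewrite /P h h' => /(_ isT); rewrite /= leqNgt -ja ji.
  case: (eqVneq i K) => [->|_]; first by rewrite corr_ge // subr0 oner_eq0.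
  case: (eqVneq i a) => [->|_]; first by rewrite mxE sa eqxx aK.
  by rewrite eqxx oner_eq0.
- move=> q qK; rewrite s'E ?s_fix ?(ltnW qK) // -val_eqE /= gtn_eqF //.
  exact: ltn_trans aK qK.
move=> c; rewrite ltnS leq_eqVlt => /orP[/eqP/val_inj ->|cK].
  rewrite -!mulmxA g_K mulmxBr mul_correction -(colE K x) opprB addrC subrK.
  by rewrite involution_mx_col // s'K aK g_a.
have cnK : c != K by rewrite -val_eqE /= ltn_eqF.
rewrite -!mulmxA involution_mx_col //.
have [->|ca] := eqVneq c a.
  by rewrite g_a mul_fixed_part s'a ltnNge (ltnW aK) mulmx0.
rewrite g_e // x_e_lt // involution_mx_col // s'E //.
case: ifP => sc; rewrite ?mulmx0 // g_e //.
  by rewrite -val_eqE /= ltn_eqF // (ltn_trans sc).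
by apply: contraNneq ca => h; rewrite -[c]sK h sa.
Qed.
End Step.

Theorem square0_orbit x : nilradical x -> x *m x = 0 ->
  exists2 s : 'S_n, involutive s & borel_orbit (involution_mx F s) x.
Proof.
suff main (m k : nat) (x' : 'M[F]_n) (s : 'S_n) : (k + m)%N = n -> nilradical x' -> x' *m x' = 0 ->
    involutive s -> (forall q : 'I_n, (k <= q)%N -> s q = q) ->
    (forall i c : 'I_n, (c < k)%N -> x' i c = involution_mx F s i c) ->
    exists2 s' : 'S_n, involutive s' & borel_orbit (involution_mx F s') x'.
  move=> xn xx; apply: (main n 0%N x 1%g) => // [q|q _]; by rewrite !perm1.
elim: m k x' s => [|m IHm] k {}x s kmn xn xx sK s_fix x_cols.
  exists s => //; rewrite (_ : x = involution_mx F s); first exact: borel_orbit_refl.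
  by apply/matrixP => i c; apply: x_cols; rewrite -[k]addn0 kmn.
have kn : (k < n)%N by lia.
have [g [s' [gB s'K s'_fix cols]]] :=
  @exists_extended_column x s (Ordinal kn) xn xx sK s_fix x_cols.
have [gU _] := gB.
have orb : borel_orbit x (invmx g *m x *m g).
  by apply: (borel_orbitI (borelV gB)); rewrite -!mulmxA mulmxV // mulmx1.
have [||||t tK orb'] := IHm k.+1 (invmx g *m x *m g) s' _ _ _ s'K s'_fix.
- by rewrite addSnnS.
- exact: borel_orbit_nilradical orb.
- exact: borel_orbit_square0 orb.
- exact: borel_conj_cols.
by exists t => //; apply: borel_orbit_trans orb' (borel_orbit_sym orb).
Qed.
End Classification.

(** * Zariski-closed sets *)

Section Closed.
Variables (F : fieldType) (n : nat).
Implicit Types (x : 'M[F]_n) (Z : set 'M[F]_n) (p : {mpoly F[n * n]}).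

(** A closed set is the zero set of its own ideal; in this form intersections
    and unions need no choice of equations. *)
Lemma zariski_closedP Z : zariski_closed Z <->
  (Z `<=` @nilradical F n) /\
  forall x, nilradical x ->
    (forall p, (forall y, Z y -> eval_entries p y = 0) -> eval_entries p x = 0) ->
    Z x.
Proof.
split=> [[E ->]|[Zn ZP]].
  split=> [x [] //|x xn xP]; split=> // p Ep.
  by apply: xP => y [_]; apply.
exists [set p | forall y, Z y -> eval_entries p y = 0].
apply/seteqP; split=> x.
  by move=> Zx; split=> [|p]; [exact: Zn | apply].
by move=> [xn xP]; apply: ZP.
Qed.

Lemma nonvanishing_polynomial (Z : set 'M[F]_n) x : zariski_closed Z -> nilradical x -> ~ Z x ->
  exists2 p, (forall y, Z y -> eval_entries p y = 0) & eval_entries p x != 0.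
Proof.
move=> /zariski_closedP[_ Zc] xn nZx; apply: contrapT => np; apply: nZx.
apply: Zc => // p pZ; apply/eqP/negPn/negP => px.
by apply: np; exists p.
Qed.

Lemma zariski_closed_bigI (I : Type) (Z : I -> set 'M[F]_n) :
  (forall i, zariski_closed (Z i)) ->
  zariski_closed [set x | nilradical x /\ forall i, Z i x].
Proof.
move=> Zc; apply/zariski_closedP; split=> [x [] //|x xn xP]; split=> // i.
have /zariski_closedP[_ Zi] := Zc i; apply: Zi => // p pZ.
by apply: xP => y [_ /(_ i) Zy]; apply: pZ.
Qed.

Lemma zariski_closedU Y Z :
  zariski_closed Y -> zariski_closed Z -> zariski_closed (Y `|` Z).
Proof.
move=> Ycl /zariski_closedP[Zn Zc]; have /zariski_closedP[Yn _] := Ycl.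
apply/zariski_closedP.
split=> [x [/Yn|/Zn] //|x xn xP].
have [Yx|nYx] := EM (Y x); [by left | right; apply: Zc => // q qZ].
have [p pY px] := nonvanishing_polynomial Ycl xn nYx.
have : eval_entries (p * q) x = 0.
  apply: xP => y Yy; rewrite /eval_entries mevalM -/(eval_entries _ _) -/(eval_entries _ _).
  by case: Yy => [/pY ->|/qZ ->]; rewrite ?mul0r ?mulr0.
rewrite /eval_entries mevalM => /eqP; rewrite mulf_eq0 -/(eval_entries _ _).
by rewrite (negPf px) => /eqP.
Qed.

Lemma zariski_closed0 : zariski_closed (set0 : set 'M[F]_n).
Proof.
exists [set 1]; apply/seteqP; split=> // x [_ /(_ 1 erefl)].
by rewrite /eval_entries meval1 => /eqP; rewrite oner_eq0.
Qed.

Lemma zariski_closed_bigU (I : eqType) (r : seq I) (Z : I -> set 'M[F]_n) :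
  (forall i, zariski_closed (Z i)) ->
  zariski_closed [set x | exists2 i, i \in r & Z i x].
Proof.
move=> Zc; elim: r => [|i r IHr].
  by rewrite (_ : [set _ | _] = set0); [exact: zariski_closed0 | apply/seteqP; split=> x // []].
rewrite (_ : [set _ | _] = Z i `|` [set x | exists2 i, i \in r & Z i x]).
  exact: zariski_closedU.
apply/seteqP; split=> x.
  by case=> k; rewrite inE => /orP[/eqP -> ?|? ?]; [left | right; exists k].
by case=> [?|[k kr ?]]; [exists i | exists k]; rewrite // inE ?eqxx ?kr ?orbT.
Qed.

Definition generic_mx : 'M[{mpoly F[n * n]}]_n :=
  \matrix_(i, j) 'X_(mxvec_index i j).

Lemma eval_generic_mx x :
  map_mx (meval (fun k => mxvec x 0 k)) generic_mx = x.
Proof. by apply/matrixP => i j; rewrite !mxE mevalXU mxvecE. Qed.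

Lemma zariski_closed_square0 :
  zariski_closed [set x : 'M[F]_n | nilradical x /\ x *m x = 0].
Proof.
exists [set p | exists i j, p = (generic_mx *m generic_mx) i j].
have ev x i j : eval_entries ((generic_mx *m generic_mx) i j) x = (x *m x) i j.
  rewrite /eval_entries -[in RHS](eval_generic_mx x) -map_mxM.
  by rewrite [in RHS]mxE.
apply/seteqP; split=> x [xn xx]; split=> //.
  by move=> p [i [j ->]]; rewrite ev xx mxE.
by apply/matrixP => i j; rewrite -ev [RHS]mxE; apply: xx; exists i, j.
Qed.

Lemma mxrank_mxsub m1 m2 n1 n2 (f : 'I_m2 -> 'I_m1) (g : 'I_n2 -> 'I_n1)
    (M : 'M[F]_(m1, n1)) : (\rank (mxsub f g M) <= \rank M)%N.
Proof.
rewrite -[M in mxsub f g M]mulmx1 mxsub_mul (leq_trans (mxrankM_maxl _ _)) //.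
by rewrite rowsubE mxrankM_maxr.
Qed.

(** Minors of all sizes above k are used, so that a maximal nonzero minor
    suffices as a witness. *)
Lemma mxrank_leP m1 n1 (k : nat) (M : 'M[F]_(m1, n1)) :
  (\rank M <= k)%N <-> forall r (f : 'I_r -> 'I_m1) (g : 'I_r -> 'I_n1),
    (k < r)%N -> \det (mxsub f g M) = 0.
Proof.
split=> [Mk r f g kr|minors].
  apply/eqP; apply: contraLR kr => d0; rewrite -leqNgt; apply: leq_trans Mk.
  have : mxsub f g M \in unitmx by rewrite unitmxE unitfE.
  by rewrite -row_free_unit => /eqP <-; apply: mxrank_mxsub.
rewrite leqNgt; apply/negP => kM.
pose A := rowsub (maxrankfun M) M.
have fullA : row_full A^T by rewrite /row_full mxrank_tr; apply: maxrowsub_free.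
have := fullrowsub_unit fullA; rewrite unitmxE unitfE -det_tr.
by rewrite trmx_mxsub trmxK -mxsubcr minors ?eqxx.
Qed.

Lemma zariski_closed_rank (i j : 'I_n) (k : nat) :
  zariski_closed [set x : 'M[F]_n | nilradical x /\ (rank_mx x i j <= k)%N].
Proof.
case: (boolP (i < j)%N) => ij; last first.
  exists set0; apply/seteqP; split=> x [xn _]; split=> //.
  by rewrite mxE (negPf ij).
pose w (a : 'I_(j - i).+1) : 'I_n := insubd i (i + a)%N.
exists [set p | exists r (f g : 'I_r -> 'I_(j - i).+1), 
  (k < r)%N /\ p = \det (mxsub (w \o f) (w \o g) generic_mx)].
have ev x r (f g : 'I_r -> 'I_(j - i).+1) :
    eval_entries (\det (mxsub (w \o f) (w \o g) generic_mx)) x =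
    \det (mxsub f g (window i j x)).
  by rewrite /eval_entries -det_map_mx map_mxsub eval_generic_mx -mxsub_comp.
apply/seteqP; split=> x [xn]; rewrite ?mxE ?ij => xP; split=> //.
  by move=> p [r [f [g [kr ->]]]]; rewrite ev; move/mxrank_leP: xP; apply.
by rewrite mxE ij; apply/mxrank_leP => r f g kr; rewrite -ev; apply: xP; exists r, f, g.
Qed.

Lemma zariski_closure_sub (A : set 'M[F]_n) Z : zariski_closed Z -> A `<=` Z ->
  zariski_closure A `<=` Z.
Proof. by move=> Zc AZ; apply: smallest_sub. Qed.

Lemma zariski_closureP (A : set 'M[F]_n) x :
  (forall Z, zariski_closed Z -> A `<=` Z -> Z x) <-> zariski_closure A x.
Proof.
split=> [h Z [Zc AZ]|clx Z Zc AZ]; first exact: h.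
exact: zariski_closure_sub clx.
Qed.

End Closed.

(** Along a rational curve with common denominator D, a power of D clears the
    denominators of the values of p. *)
Lemma meval_quotient (F : fieldType) (m : nat) (v : 'I_m -> {poly F})
    (D : {poly F}) (p : {mpoly F[m]}) :
  exists P d, forall t, D.[t] != 0 ->
    P.[t] = D.[t] ^+ d * p.@[fun k => (v k).[t] / D.[t]].
Proof.
elim/mpolyind: p => [|c mm p _ _ [P [d Pp]]].
  by exists 0, 0%N => t _; rewrite horner0 meval0 mulr0.
exists ((c *: \prod_i v i ^+ mm i) * D ^+ d + P * D ^+ (mdeg mm)), (mdeg mm + d)%N.
move=> t Dt; rewrite mevalD mevalZ mevalX !hornerE horner_prod Pp // mulrDr.
congr (_ + _); last by rewrite exprD; ring.
rewrite (eq_bigr (fun i => (v i).[t] ^+ mm i)) => [|i _]; last by rewrite horner_exp.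
rewrite [in RHS](eq_bigr (fun i => (v i).[t] ^+ mm i * D.[t]^-1 ^+ mm i)) => [|i _].
  rewrite big_split /= prodrXr -mdegE exprVn exprD.
  by field; rewrite expf_neq0.
by rewrite exprMn.
Qed.

Lemma exists_nonroot (F : numFieldType) (P : {poly F}) : P != 0 -> exists t, P.[t] != 0.
Proof.
move=> P0; apply: contrapT => noroot.
have := @max_poly_roots _ P [seq i%:R | i <- iota 0 (size P)] P0.
rewrite size_map size_iota ltnn => h; apply: notF; apply: h.
  apply/allP => _ /mapP[i _ ->]; apply/negPn/negP => h; apply: noroot.
  by exists i%:R.
by rewrite map_inj_uniq ?iota_uniq // => i j /eqP; rewrite eqr_nat => /eqP.
Qed.

(** A polynomial vanishing on a line outside one point has infinitely many zeros
    on the line, so it vanishes at that point too. *)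
Lemma zariski_closed_limit (F : numFieldType) (n : nat) (Z : set 'M[F]_n) (x y : 'M[F]_n) :
  zariski_closed Z -> (forall t, t != 0 -> Z (x + t *: y)) -> Z x.
Proof.
move=> /zariski_closedP[Zn Zc] Zxy; apply: Zc.
  move=> i j ji; have h1 := Zn _ (Zxy 1 (oner_neq0 _)) i j ji.
  have h2 : (x + (-1) *: y) i j = 0 by apply: (Zn _ (Zxy _ _)); rewrite ?oppr_eq0 ?oner_eq0.
  have : (x i j) *+ 2 = 0 by rewrite -[RHS]addr0 -{1}h1 -{1}h2 !mxE; ring.
  by move=> /eqP; rewrite mulrn_eq0 /= => /eqP.
move=> p pZ; apply/eqP/negPn/negP => px.
pose v k := (mxvec x 0 k)%:P + (mxvec y 0 k) *: 'X.
have [P [d PE]] := meval_quotient v 1 p.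
have {}PE t : P.[t] = eval_entries p (x + t *: y).
  rewrite PE hornerC ?oner_neq0 // expr1n mul1r; apply: meval_eq => k.
  by rewrite divr1 linearD linearZ !mxE /v !hornerE mulrC.
have P0 : P * 'X != 0.
  rewrite mulf_neq0 ?polyX_eq0 //; apply: contraNneq px => P0.
  by have := PE 0; rewrite P0 horner0 scale0r addr0 => <-.
have [t] := exists_nonroot P0; rewrite !hornerE mulf_eq0 negb_or => /andP[Pt t0].
by case/eqP: Pt; rewrite PE; apply: pZ; apply: Zxy.
Qed.

(** * Elementary degenerations as limits of orbits *)

Section Degenerations.
Variables (F : numFieldType) (n : nat).
Implicit Types (s r : 'S_n) (i j p l m f : 'I_n) (b x y : 'M[F]_n) (t : F).
Local Notation N := (involution_mx F).
Local Notation E := (@delta_mx F n n).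

(** The inclusion of B.N_s' in the closure of B.N_s, phrased with closed sets so
    that it is transitive by construction. *)
Definition degenerates_to s s' := forall Z : set 'M[F]_n, zariski_closed Z ->
  borel_orbit (N s) `<=` Z -> borel_orbit (N s') `<=` Z.

Lemma degenerates_along_line s s' y :
  (forall t, t != 0 -> borel_orbit (N s) (N s' + t *: y)) -> degenerates_to s s'.
Proof.
move=> orb Z Zc sZ _ [b bB <-].
apply: (@zariski_closed_limit _ _ _ _ (b *m y *m invmx b) Zc) => t t0.
apply: sZ; apply: borel_orbit_trans (orb t t0) _.
by exists b => //; rewrite mulmxDr mulmxDl -scalemxAr -scalemxAl.
Qed.

Lemma involution_mx_arc r i j : involutive r -> r i = i -> r j = j -> (i < j)%N ->
  N (tperm i j * r)%g = N r + E i j.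
Proof.
move=> rK ri rj ij; apply/matrixP => u v; rewrite !mxE permM -natrD; congr (_%:R).
have neq_ij : (i == j) = false by rewrite -val_eqE /= ltn_eqF.
case: (tpermP i j u) => [->|->|/eqP/negPf ui _]; last by rewrite ui addn0.
  rewrite rj ri eqxx /= (eq_sym v); case: (eqVneq j v) => [<-|_].
    by rewrite ij neq_ij andbF.
  by case: (eqVneq i v) => [<-|_]; rewrite ?ltnn ?andbF.
rewrite ri rj (eq_sym j) neq_ij addn0.
case: (eqVneq i v) => [<-|_]; first by rewrite ltnNge (ltnW ij); case: eqP neq_ij.
by rewrite andbF; case: (eqVneq j v) => [<-|_]; rewrite ?ltnn ?andbF.
Qed.

Lemma tperm_involutive r i j : involutive r -> r i = i -> r j = j -> 
  involutive (tperm i j * r)%g.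
Proof.
move=> rK ri rj x; rewrite !permM.
case: (tpermP i j x) => [->|->|/eqP xi /eqP xj].
- by rewrite rj tpermR.
- by rewrite ri tpermL.
rewrite tpermD ?rK //; first by apply: contraNneq xi => h; rewrite -[x]rK -h ri.
by apply: contraNneq xj => h; rewrite -[x]rK -h rj.
Qed.

Lemma delta_mul_involution r (i j : 'I_n) : r j = j -> E i j *m N r = 0.
Proof.
move=> rj; apply/matrixP => u v; rewrite !mxE big1 // => k _; rewrite !mxE.
case: (eqVneq k j) => [->|]; last by rewrite andbF mul0r.
by rewrite rj; case: (eqVneq j v) => [->|]; rewrite ?ltnn ?andbF mulr0.
Qed.

Lemma involution_mul_delta r (i j : 'I_n) : involutive r -> r i = i -> N r *m E i j = 0.
Proof.
move=> rK ri; apply/matrixP => u v; rewrite !mxE big1 // => k _; rewrite !mxE.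
case: (eqVneq k i) => [->|]; last by rewrite mulr0.
case: (eqVneq (r u) i) => [h|]; last by rewrite andbF mul0r.
by rewrite -{1}[u]rK h ri ltnn mul0r.
Qed.

Lemma borel_add_upper b i j (c : F) : borel b -> (i < j)%N -> borel (b + c *: E i j).
Proof.
move=> /borelP[bu bd] ij; apply/borelP; split=> [u v vu|u].
  rewrite !mxE bu // add0r; case: eqP => [ui|_]; last by rewrite mulr0.
  case: eqP => [vj|_]; last by rewrite mulr0.
  by move: vu; rewrite ui vj ltnNge ltnW.
rewrite !mxE; case: (eqVneq u i) => [ui|_]; last by rewrite mulr0 addr0.
case: (eqVneq u j) => [uj|_]; last by rewrite mulr0 addr0.
by move: ij; rewrite -ui -uj ltnn.
Qed.

Lemma borel_add_diag b i (c : F) : borel b -> b i i + c != 0 -> borel (b + c *: E i i).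
Proof.
move=> /borelP[bu bd] bi; apply/borelP; split=> [u v vu|u].
  rewrite !mxE bu // add0r; case: eqP => [ui|_]; last by rewrite mulr0.
  case: eqP => [vj|_]; last by rewrite mulr0.
  by move: vu; rewrite ui vj ltnn.
by rewrite !mxE; case: (eqVneq u i) => [->|_]; rewrite ?mulr0 ?addr0 // mulr1.
Qed.

Lemma delta_mulC (i j k l : 'I_n) : E i j *m E k l = if j == k then E i l else 0.
Proof. by rewrite mul_delta_mx_cond; case: eqP. Qed.


(** Matrix units supported on fixed points of r annihilate N_r on both sides, so
    products reduce to products of matrix units. *)
Ltac delta_algebra :=
  rewrite ?(mulmxDl, mulmxDr) ?mul1mx ?mulmx1 -?scalemxAl -?scalemxAr;
  rewrite ?(mulmxDl, mulmxDr) -?scalemxAl -?scalemxAr;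
  rewrite ?delta_mulC ?delta_mul_involution ?involution_mul_delta //.

(** In this lemma and the next four, the element of B solves
    b *m N s = (N s' + t *: y) *m b.  It differs from the identity only on
    points fixed by r, hence commutes with N r, and the equation reduces to one
    for matrices of size at most 4. *)
Lemma degenerate_delete r i j : involutive r -> r i = i -> r j = j -> (i < j)%N ->
  degenerates_to (tperm i j * r)%g r.
Proof.
move=> rK ri rj ij; apply: (@degenerates_along_line _ _ (E i j)) => t t0.
apply: (@borel_orbitI _ _ (1%:M + (t - 1) *: E i i)).
  by apply: borel_add_diag (borel1 _ _) _; rewrite mxE eqxx addrC subrK.
have ji : (j == i) = false by rewrite -val_eqE /= gtn_eqF.
rewrite involution_mx_arc //; delta_algebra; rewrite ?eqxx ji.
by apply/matrixP => u v; rewrite !mxE; ring.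
Qed.

Lemma degenerate_left_end r p i j : involutive r -> r p = p -> r i = i -> r j = j ->
  (p < i)%N -> (i < j)%N -> degenerates_to (tperm i j * r)%g (tperm p j * r)%g.
Proof.
move=> rK rp ri rj pi ij; apply: (@degenerates_along_line _ _ (E i j)) => t t0.
have pj := ltn_trans pi ij.
apply: (@borel_orbitI _ _ (1%:M + (t - 1) *: E i i + 1 *: E p i)).
  apply: borel_add_upper => //; apply: borel_add_diag (borel1 _ _) _.
  by rewrite mxE eqxx addrC subrK.
have ji : (j == i) = false by rewrite -val_eqE /= gtn_eqF.
have jp : (j == p) = false by rewrite -val_eqE /= gtn_eqF.
rewrite !involution_mx_arc //; delta_algebra; rewrite ?eqxx ?ji ?jp.
by apply/matrixP => u v; rewrite !mxE; ring.
Qed.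

Lemma degenerate_right_end r i j f : involutive r -> r i = i -> r j = j -> r f = f ->
  (i < j)%N -> (j < f)%N -> degenerates_to (tperm i j * r)%g (tperm i f * r)%g.
Proof.
move=> rK ri rj rf ij jf; apply: (@degenerates_along_line _ _ (E i j)) => t t0.
have if' := ltn_trans ij jf.
apply: (@borel_orbitI _ _ (1%:M + (t^-1 - 1) *: E j j + (- t^-1) *: E j f)).
  apply: borel_add_upper => //; apply: borel_add_diag (borel1 _ _) _.
  by rewrite mxE eqxx addrC subrK invr_eq0.
have ji : (j == i) = false by rewrite -val_eqE /= gtn_eqF.
have fj : (f == j) = false by rewrite -val_eqE /= gtn_eqF.
have fi : (f == i) = false by rewrite -val_eqE /= gtn_eqF.
rewrite !involution_mx_arc //; delta_algebra; rewrite ?eqxx ?ji ?fj ?fi.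
by apply/matrixP => u v; rewrite !mxE; field.
Qed.

Lemma degenerate_crossing_disjoint r m p i j : involutive r ->
  r m = m -> r p = p -> r i = i -> r j = j ->
  (m < p)%N -> (p < i)%N -> (i < j)%N ->
  degenerates_to (tperm m p * (tperm i j * r))%g (tperm m i * (tperm p j * r))%g.
Proof.
move=> rK rm rp ri rj mp pi ij.
apply: (@degenerates_along_line _ _ (E i j + (-1) *: E m p)) => t t0.
have mi := ltn_trans mp pi; have pj := ltn_trans pi ij; have mj := ltn_trans mi ij.
have lt_neq (u v : 'I_n) : (u < v)%N -> ((u == v) = false) * ((v == u) = false).
  by move=> uv; split; rewrite -val_eqE /= ?(ltn_eqF uv) ?(gtn_eqF uv).
have [[Emp Epm] [Epi Eip] [Eij Eji]] :=
  And3 (lt_neq _ _ mp) (lt_neq _ _ pi) (lt_neq _ _ ij).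
have [[Emi Eim] [Epj Ejp] [Emj Ejm]] :=
  And3 (lt_neq _ _ mi) (lt_neq _ _ pj) (lt_neq _ _ mj).
have Es := (Emp, Epm, Epi, Eip, Eij, Eji, Emi, Eim, (Epj, Ejp, Emj, Ejm)).
apply: (@borel_orbitI _ _ (1%:M + (- t ^+ 2 - 1) *: E m m + (t - 1) *: E p p
                           + (t - 1) *: E i i + 1 *: E p i)).
  have one_add c : 1 + (c - 1) = c :> F by rewrite addrC subrK.
  apply: borel_add_upper => //; do 3![apply: borel_add_diag; last
    by rewrite !mxE ?eqxx ?Es /= ?mulr0 ?addr0 one_add ?oppr_eq0 ?expf_neq0].
  exact: borel1.
rewrite !involution_mx_arc ?permM ?tpermD ?Es //; try exact: tperm_involutive.
delta_algebra; rewrite ?eqxx ?Es.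
by apply/matrixP => u v; rewrite !mxE; ring.
Qed.

Lemma degenerate_crossing_nested r p i j l : involutive r ->
  r p = p -> r i = i -> r j = j -> r l = l ->
  (p < i)%N -> (i < j)%N -> (j < l)%N ->
  degenerates_to (tperm p l * (tperm i j * r))%g (tperm i l * (tperm p j * r))%g.
Proof.
move=> rK rp ri rj rl pi ij jl.
apply: (@degenerates_along_line _ _ (E i j)) => t t0.
have pj := ltn_trans pi ij; have il := ltn_trans ij jl; have pl := ltn_trans pj jl.
have lt_neq (u v : 'I_n) : (u < v)%N -> ((u == v) = false) * ((v == u) = false).
  by move=> uv; split; rewrite -val_eqE /= ?(ltn_eqF uv) ?(gtn_eqF uv).
have [[Epi Eip] [Eij Eji] [Ejl Elj]] :=
  And3 (lt_neq _ _ pi) (lt_neq _ _ ij) (lt_neq _ _ jl).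
have [[Epj Ejp] [Eil Eli] [Epl Elp]] :=
  And3 (lt_neq _ _ pj) (lt_neq _ _ il) (lt_neq _ _ pl).
have Es := (Epi, Eip, Eij, Eji, Ejl, Elj, Epj, Ejp, (Eil, Eli, Epl, Elp)).
apply: (@borel_orbitI _ _ (1%:M + (t - 1) *: E i i + (- t - 1) *: E l l
                           + 1 *: E p i + 1 *: E j l)).
  have one_add c : 1 + (c - 1) = c :> F by rewrite addrC subrK.
  do 2![apply: borel_add_upper => //]; do 2![apply: borel_add_diag; last
    by rewrite !mxE ?eqxx ?Es /= ?mulr0 ?addr0 one_add ?oppr_eq0].
  exact: borel1.
rewrite !involution_mx_arc ?permM ?tpermD ?Es //; try exact: tperm_involutive.
delta_algebra; rewrite ?eqxx ?Es.
by apply/matrixP => u v; rewrite !mxE; ring.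
Qed.

Lemma delete_arcE s i : involutive s -> (i < s i)%N ->
  exists r, [/\ involutive r, r i = i, r (s i) = s i,
    forall q, q != i -> q != s i -> r q = s q & s = (tperm i (s i) * r)%g].
Proof.
move=> sK lti; exists (tperm i (s i) * s)%g; split.
- exact: degeneration_involutive (DeleteArc lti).
- by rewrite permM tpermL sK.
- by rewrite permM tpermR.
- by move=> q qi qs; rewrite permM tpermD // eq_sym.
by rewrite mulgA tperm2 mul1g.
Qed.

(** Bookkeeping for the moves that involve two arcs: what remains after removing
    them fixes their four ends. *)
Lemma delete_two_arcsE s i (k : 'I_n) : involutive s -> (i < s i)%N -> (k < s k)%N -> k != i ->
  exists r, [/\ involutive r, r i = i /\ r (s i) = s i, r k = k /\ r (s k) = s k
    & s = (tperm k (s k) * (tperm i (s i) * r))%g].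
Proof.
move=> sK lti ltk ki; have [r [rK ri rj rq sE]] := delete_arcE sK lti.
have ksi : k != s i by apply: contraTneq ltk => ->; rewrite sK -leqNgt ltnW.
have skk : r k = s k by rewrite rq.
have := @delete_arcE r k rK; rewrite skk => /(_ ltk)[r' [r'K r'k r'sk r'q rE]].
have ski : s k != i by apply: contraNneq ksi => <-; rewrite sK.
have sksi : s k != s i by rewrite (inj_eq perm_inj).
exists r'; split=> //; first by rewrite !r'q // eq_sym.
rewrite {1}sE rE mulgA (conjgC (tperm i _)) tpermJ -mulgA; congr (_ * (_ * _))%g.
by rewrite !tpermD.
Qed.

Lemma conj_tperm_fixed r i j : r i = i -> r j = j -> (r ^ tperm i j)%g = r.
Proof.
move=> ri rj; apply/permP => q; rewrite conj_tpermE.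
case: (tpermP i j q) => [->|->|/eqP qi /eqP qj].
- by rewrite rj tpermR.
- by rewrite ri tpermL.
rewrite tpermD //; first by apply: contraNneq qi => h; apply/eqP/(@perm_inj _ r); rewrite ri.
by apply: contraNneq qj => h; apply/eqP/(@perm_inj _ r); rewrite rj.
Qed.

Lemma degeneration_degenerates_to s s' : involutive s ->
  degeneration s s' -> degenerates_to s s'.
Proof.
move=> sK; case=> [i lti|p i ltpi lti sp|i f lti ltf sf].
- have [r [rK ri rj _ sE]] := delete_arcE sK lti.
  by rewrite {1 3}sE mulgA tperm2 mul1g; apply: degenerate_delete.
- have [r [rK ri rj rq sE]] := delete_arcE sK lti.
  have pi : p != i by rewrite -val_eqE /= ltn_eqF.
  have psi : p != s i by rewrite -val_eqE /= ltn_eqF // (ltn_trans ltpi).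
  have isi : i != s i by rewrite -val_eqE /= ltn_eqF.
  have conj_ij : (tperm i (s i) ^ tperm p i = tperm p (s i))%g.
    by rewrite tpermJ tpermR tpermD.
  case: (ltngtP (s p) p) sp => [ltp _|ltp /= ltj|/val_inj sp _].
  + have spi : s p != i by rewrite -val_eqE /= ltn_eqF // (ltn_trans ltp).
    have spsi : s p != s i by rewrite (inj_eq perm_inj).
    have := @delete_two_arcsE s i (s p) sK lti; rewrite sK => /(_ ltp spi).
    move=> [r' [r'K [r'i r'j] [r'm r'p] sE']].
    have -> : (s ^ tperm p i = tperm (s p) i * (tperm p (s i) * r'))%g.
      rewrite {1}sE' !conjMg conj_ij (conj_tperm_fixed r'p r'i) tpermJ tpermL tpermD //.
        by rewrite -val_eqE /= gtn_eqF.
      by rewrite eq_sym.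
    by rewrite {1}sE'; apply: degenerate_crossing_disjoint.
  + have ltsp : (p < s p)%N by rewrite (ltn_trans ltpi) // (ltn_trans lti).
    have [r' [r'K [r'i r'j] [r'p r'l] sE']] := delete_two_arcsE sK lti ltsp pi.
    have -> : (s ^ tperm p i = tperm i (s p) * (tperm p (s i) * r'))%g.
      rewrite {1}sE' !conjMg conj_ij (conj_tperm_fixed r'p r'i) tpermJ tpermL tpermD //.
        by rewrite -val_eqE /= ltn_eqF.
      by rewrite -val_eqE /= ltn_eqF // (ltn_trans lti).
    by rewrite {1}sE'; apply: degenerate_crossing_nested.
  + have rp : r p = p by rewrite rq.
    rewrite {2}sE conjMg conj_ij (conj_tperm_fixed rp ri) {1}sE.
    exact: degenerate_left_end.
have [r [rK ri rj rq sE]] := delete_arcE sK lti.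
have fi : f != i by rewrite -val_eqE /= gtn_eqF // (ltn_trans lti).
have fsi : f != s i by rewrite -val_eqE /= gtn_eqF.
have rf : r f = f by rewrite rq.
have conj_ij : (tperm i (s i) ^ tperm (s i) f = tperm i f)%g.
  by rewrite tpermJ tpermL tpermD // -val_eqE /= gtn_eqF.
rewrite {2}sE conjMg conj_ij (conj_tperm_fixed rj rf) {1}sE.
exact: degenerate_right_end.
Qed.
End Degenerations.

(** * Orbit closures and their intersections *)

Section OrbitClosure.
Variables (F : numFieldType) (n : nat).
Implicit Types (s t : 'S_n) (x y : 'M[F]_n).
Local Notation N := (involution_mx F).

Lemma rank_mx_involution_orbit s x : borel_orbit (N s) x ->
  rank_mx x = involution_rank_mx F s.
Proof. by apply: rank_mx_orbit; apply/nilradical_upper/nilradical_involution_mx. Qed.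

Lemma zariski_closed_rank_le (A : 'M[nat]_n) :
  zariski_closed [set x : 'M[F]_n | nilradical x /\ le_natmx (rank_mx x) A].
Proof.
rewrite (_ : [set x | _] = [set x | nilradical x /\ forall ij : 'I_n * 'I_n,
    nilradical x /\ (rank_mx x ij.1 ij.2 <= A ij.1 ij.2)%N]).
  by apply: zariski_closed_bigI => ij; apply: zariski_closed_rank.
apply/seteqP; split=> x [xn h]; split=> //.
by move=> i j; case: (h (i, j)).
Qed.

Lemma degenerates_to_rank_le s t : degenerates_to F s t ->
  le_natmx (involution_rank_mx F t) (involution_rank_mx F s).
Proof.
move=> st; have [_] := st _ (zariski_closed_rank_le (involution_rank_mx F s))
  (fun x h => conj (borel_orbit_nilradical (nilradical_involution_mx F s) h)
     (fun i j => eq_leq (congr1 (fun A : 'M_n => A i j) (rank_mx_involution_orbit h))))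
  _ (borel_orbit_refl (N t)).
exact.
Qed.

(** Induction on the sum of the entries of the rank matrix: a move that stays
    above t lowers this sum, because rank matrices separate involutions. *)
Lemma rank_le_degenerates_to s t : involutive s -> involutive t ->
  le_natmx (involution_rank_mx F t) (involution_rank_mx F s) ->
  degenerates_to F s t.
Proof.
move=> sK tK le_ts.
have [m] := ubnP (\sum_(ij : 'I_n * 'I_n) involution_rank_mx F s ij.1 ij.2)%N.
elim: m s sK le_ts => // m IHm s sK le_ts lt_sm.
have [->|neq_st] := EM (s = t); first by move=> Z.
have [|s' ss' le_ts'] := exists_degeneration sK tK neq_st.
  exact/involution_rank_mx_le.
have s'K := degeneration_involutive sK ss'.
have dss' := degeneration_degenerates_to (F := F) sK ss'.
have le_s's := degenerates_to_rank_le dss'.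
have ds't : degenerates_to F s' t.
  apply: IHm => //; first exact/involution_rank_mx_le.
  rewrite ltnS in lt_sm; apply: leq_trans lt_sm.
  rewrite ltnNge; apply/negP => ge_s's; apply: (degeneration_neq sK ss').
  apply: (@involution_rank_mx_inj F) => //; apply/matrixP => i j.
  have := leqif_sum (fun (ij : 'I_n * 'I_n) (_ : true) => leqif_eq (le_s's ij.1 ij.2)).
  case=> le_sum; rewrite eqn_leq le_sum ge_s's => /esym/forallP/(_ (i, j)).
  by move/eqP.
by move=> Z Zc sZ; apply: ds't => //; apply: dss'.
Qed.

Theorem zariski_closure_orbitP s x : involutive s ->
  zariski_closure (borel_orbit (N s)) x <->
  exists t, [/\ involutive t,
    le_natmx (involution_rank_mx F t) (involution_rank_mx F s) & borel_orbit (N t) x].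
Proof.
move=> sK; split=> [clx|[t [tK le_ts tx]]]; last first.
  by apply/zariski_closureP => Z Zc sZ; apply: rank_le_degenerates_to tx.
have sub : zariski_closure (borel_orbit (N s)) `<=` [set x : 'M[F]_n | nilradical x /\ x *m x = 0].
  apply: zariski_closure_sub (@zariski_closed_square0 _ _) _ => y sy; split.
    by apply: borel_orbit_nilradical sy; apply: nilradical_involution_mx.
  by apply: borel_orbit_square0 sy; apply: involution_mx_square0.
have [xn xx] := sub x clx.
have [t tK tx] := square0_orbit xn xx; exists t; split=> //.
rewrite -(rank_mx_involution_orbit tx).
have subr : zariski_closure (borel_orbit (N s)) `<=`
    [set x | nilradical x /\ le_natmx (rank_mx x) (involution_rank_mx F s)].
  apply: zariski_closure_sub (zariski_closed_rank_le _) _ => y sy; split.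
    by apply: borel_orbit_nilradical sy; apply: nilradical_involution_mx.
  by rewrite (rank_mx_involution_orbit sy).
by have [] := subr x clx.
Qed.

Definition line_mx (b c : 'M[F]_n) : 'M[{poly F}]_n :=
  map_mx polyC b + 'X *: map_mx polyC (c - b).

Lemma line_mxE b c (u : F) : map_mx (horner_eval u) (line_mx b c) = b + u *: (c - b).
Proof. by apply/matrixP => i j; rewrite !mxE /horner_eval !hornerE. Qed.

Lemma det_line_mx b c (u : F) : (\det (line_mx b c)).[u] = \det (b + u *: (c - b)).
Proof. by rewrite -line_mxE det_map_mx. Qed.

(** The inverse of g is its adjugate divided by its determinant, so the values of
    p at the conjugates of x by the points of a line are rational functions
    whose denominators are powers of the determinant. *)
Lemma conj_line_polynomial (b c x : 'M[F]_n) (p : {mpoly F[n * n]}) :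
  exists P d, forall u : F, let g := b + u *: (c - b) in g \in unitmx ->
    P.[u] = \det g ^+ d * eval_entries p (g *m x *m invmx g).
Proof.
pose G := line_mx b c.
pose V := G *m map_mx polyC x *m \adj G.
have VE (t : F) : map_mx (horner_eval t) V = (b + t *: (c - b)) *m x *m \adj (b + t *: (c - b)).
  rewrite /V !map_mxM map_mx_adj line_mxE; congr (_ *m _ *m _).
  by apply/matrixP => i j; rewrite !mxE /= /horner_eval hornerC.
have [P [d PE]] := meval_quotient (fun k => mxvec V 0 k) (\det G) p.
exists P, d => t g gU.
have g0 : \det g != 0 by rewrite -unitfE -unitmxE.
rewrite PE det_line_mx //; congr (_ * _); apply: meval_eq => k.
rewrite /invmx gU -scalemxAr linearZ /= -VE -map_mxvec [RHS]mxE.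
by rewrite mulrC; congr (_ * _); rewrite mxE.
Qed.

(** If one point of the orbit is outside Y and another one outside Z, then the
    generic point of the line joining the corresponding elements of B is
    invertible and conjugates x outside both Y and Z. *)
Lemma irreducible_closure_orbit x : nilradical x ->
  zariski_irreducible (zariski_closure (borel_orbit x)).
Proof.
move=> xn; set A := zariski_closure _.
have orbA : borel_orbit x `<=` A by apply: sub_smallest.
split; first by exists x; apply: orbA; apply: borel_orbit_refl.
move=> Y Z Yc Zc AYZ.
suff [oY|oZ] : borel_orbit x `<=` Y \/ borel_orbit x `<=` Z.
- by left; apply: setIidl; apply: (zariski_closure_sub Yc oY).
- by right; apply: setIidl; apply: (zariski_closure_sub Zc oZ).
apply: contrapT => /not_orP[/existsNP[y /not_implyP[xy nYy]] /existsNP[z /not_implyP[xz nZz]]].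
have [p pY py] := nonvanishing_polynomial Yc (borel_orbit_nilradical xn xy) nYy.
have [q qZ qz] := nonvanishing_polynomial Zc (borel_orbit_nilradical xn xz) nZz.
case: xy xz => b bB yE [c cB zE]; subst y z.
have [P [d PE]] := conj_line_polynomial b c x p.
have [Q [e QE]] := conj_line_polynomial b c x q.
have [bU bu] := bB; have [cU cu] := cB.
have det0 (g : 'M[F]_n) : g \in unitmx -> \det g != 0 by rewrite unitmxE unitfE.
have P0 : P != 0.
  have := PE 0; rewrite scale0r addr0 => /(_ bU).
  by apply: contra_eqN => /eqP ->; rewrite horner0 eq_sym mulf_neq0 ?expf_neq0 ?det0.
have Q0 : Q != 0.
  have := QE 1; rewrite scale1r addrCA subrr addr0 => /(_ cU).
  by apply: contra_eqN => /eqP ->; rewrite horner0 eq_sym mulf_neq0 ?expf_neq0 ?det0.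
have G0 : \det (line_mx b c) != 0.
  apply: contraTneq bU => G0; rewrite unitmxE unitfE negbK.
  by have := det_line_mx b c 0; rewrite G0 horner0 scale0r addr0 => <-.
have [t] := exists_nonroot (mulf_neq0 (mulf_neq0 P0 Q0) G0).
rewrite !hornerM !mulf_eq0 !negb_or det_line_mx => /andP[/andP[Pt Qt] gt].
have gU : b + t *: (c - b) \in unitmx by rewrite unitmxE unitfE.
have gB : borel (b + t *: (c - b)).
  by split=> // i j ji; rewrite !mxE bu // cu // subrr mulr0 addr0.
set w := (b + t *: (c - b)) *m x *m invmx (b + t *: (c - b)).
have : A w by apply: orbA; exists (b + t *: (c - b)).
rewrite AYZ => -[[_ /pY w0]|[_ /qZ w0]].
  by move: Pt; rewrite PE // w0 mulr0 eqxx.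
by move: Qt; rewrite QE // w0 mulr0 eqxx.
Qed.

Lemma irreducible_bigU (I : eqType) (r : seq I) (A : set 'M[F]_n) (Z : I -> set 'M[F]_n) :
  zariski_irreducible A -> (forall i, zariski_closed (Z i)) ->
  (forall x, A x -> exists2 i, i \in r & Z i x) -> exists2 i, i \in r & A `<=` Z i.
Proof.
move=> [[x Ax] Airr] Zc; elim: r => [|i r IHr] cover; first by case: (cover x Ax).
have rc := zariski_closed_bigU r Zc.
have [|<-|Ar] := Airr _ _ (Zc i) rc.
- apply/seteqP; split=> y; last by case=> [[]|[]].
  move=> Ay; have [k] := cover y Ay; rewrite inE => /orP[/eqP ->|kr] Zk; first by left.
  by right; split=> //; exists k.
- by exists i; rewrite ?inE ?eqxx // => y [].
have [|k kr Ak] := IHr; first by rewrite -{1}Ar => y [].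
by exists k => //; rewrite inE kr orbT.
Qed.

Lemma min_rank_mxE s t i j : min_rank_mx F s t i j =
  minn (arcs_in s i j.+1) (arcs_in t i j.+1).
Proof. by rewrite mxE !rank_involution_mx. Qed.

Lemma le_min_rank_mx (A : 'M[nat]_n) s t :
  le_natmx A (min_rank_mx F s t) <->
  le_natmx A (involution_rank_mx F s) /\ le_natmx A (involution_rank_mx F t).
Proof.
have minE i j : min_rank_mx F s t i j =
    minn (involution_rank_mx F s i j) (involution_rank_mx F t i j) by rewrite mxE.
split=> [le_A|[le_s le_t] i j]; last by rewrite minE leq_min le_s le_t.
by split=> i j; have := le_A i j; rewrite minE leq_min => /andP[].
Qed.

(** The entry of the minimum at (i, j) is attained by the spread arcs of the
    window, whose counts are at most those of any involution with at least as
    many arcs in it. *)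
Lemma exists_min_rank s s' (i j : 'I_n) : involutive s -> involutive s' ->
  exists t, [/\ involutive t, le_natmx (involution_rank_mx F t) (min_rank_mx F s s') &
    min_rank_mx F s s' i j = involution_rank_mx F t i j].
Proof.
move=> sK s'K; rewrite min_rank_mxE; set k := minn _ _.
have kk : (k.*2 <= j.+1 - i)%N.
  have := arcs_in_double i j.+1 sK; rewrite /k; lia.
have [t [tK kt tle]] := exists_spread_arcs (ltn_ord j) kk.
have le_t (u : 'S_n) : involutive u -> (k <= arcs_in u i j.+1)%N ->
    forall a b, (arcs_in t a b <= arcs_in u a b)%N.
  move=> uK ku a b; have := tle a b; have := arcs_in_shrink i a j.+1 b uK; lia.
have ts := le_t s sK (geq_minl _ _); have ts' := le_t s' s'K (geq_minr _ _).
exists t; split=> // [a b|].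
  by rewrite min_rank_mxE rank_involution_mx leq_min ts ts'.
by rewrite rank_involution_mx; apply/eqP; rewrite eqn_leq kt leq_min ts ts'.
Qed.

Theorem closure_intersection s s' (hs : involutions s) (hs' : involutions s')
  (I := zariski_closure (borel_orbit (N s)) `&` zariski_closure (borel_orbit (N s')))
  (T := [set t | involutions t /\
          le_natmx (involution_rank_mx F t) (min_rank_mx F s s')]) :
  [/\ I = \bigcup_(t in T) borel_orbit (N t),
      trivIset T (fun t => borel_orbit (N t)) &
      zariski_irreducible I <-> involution_rank_mxs F (min_rank_mx F s s')].
Proof.
have sK := involutionsK hs; have s'K := involutionsK hs'.
have IE : I = \bigcup_(t in T) borel_orbit (N t).
  apply/seteqP; split=> x.
    move=> [/zariski_closure_orbitP-/(_ sK)[t [tK ts tx]]].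
    move=> /zariski_closure_orbitP-/(_ s'K)[t' [t'K t's t'x]].
    exists t => //; split; first exact: involutive_involutions.
    apply/le_min_rank_mx; split=> //.
    by rewrite -(rank_mx_involution_orbit tx) (rank_mx_involution_orbit t'x).
  move=> [t [/involutionsK tK /le_min_rank_mx[ts ts']] tx].
  by split; apply/zariski_closure_orbitP => //; exists t.
have rankI x : I x -> le_natmx (rank_mx x) (min_rank_mx F s s').
  by rewrite IE => -[t [_ ts] tx]; rewrite (rank_mx_involution_orbit tx).
split=> //.
  move=> t t' [/involutionsK tK _] [/involutionsK t'K _] [x [tx t'x]].
  apply: (@involution_rank_mx_inj F) => //.
  by rewrite -(rank_mx_involution_orbit tx) (rank_mx_involution_orbit t'x).
split=> [Iirr|[u uu uE]]; last first.
  have uK := involutionsK uu.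
  rewrite (_ : I = zariski_closure (borel_orbit (N u))).
    exact/irreducible_closure_orbit/nilradical_involution_mx.
  rewrite IE; apply/seteqP; split=> x.
    move=> [t [tT ts] tx]; apply/zariski_closure_orbitP => //.
    by exists t; split=> //; [exact: involutionsK | rewrite uE].
  move=> /zariski_closure_orbitP-/(_ uK)[t [tK tu tx]].
  by exists t => //; split; [exact: involutive_involutions | rewrite -uE].
have [x Ix xmax] : exists2 x, I x &
    forall i j, (min_rank_mx F s s' i j <= rank_mx x i j)%N.
  apply: contrapT => nox.
  (* The points where the rank at ij is less than the minimum; there are none if
     the minimum is 0. *)
  pose Z (ij : 'I_n * 'I_n) : set 'M[F]_n := if min_rank_mx F s s' ij.1 ij.2 is k.+1
    then [set x | nilradical x /\ (rank_mx x ij.1 ij.2 <= k)%N] else set0.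
  have Zc ij : zariski_closed (Z ij).
    rewrite /Z; case: (min_rank_mx _ _ _ _ _) => [|k]; first exact: zariski_closed0.
    exact: zariski_closed_rank.
  have [x Ix|[i j] _ IZ] := irreducible_bigU (r := enum {: 'I_n * 'I_n}) Iirr Zc.
    have [ij lt_ij] : exists ij : 'I_n * 'I_n,
        (rank_mx x ij.1 ij.2 < min_rank_mx F s s' ij.1 ij.2)%N.
      apply: contrapT => noij; apply: nox; exists x => // i j.
      by rewrite leqNgt; apply/negP => h; apply: noij; exists (i, j).
    exists ij; first by rewrite mem_enum.
    rewrite /Z; case: (min_rank_mx _ _ _ _ _) lt_ij => [//|k] ltk; split=> //.
    move: Ix; rewrite IE => -[t _ tx].
    exact: borel_orbit_nilradical (nilradical_involution_mx F t) tx.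
  have [t [tK ts tij]] := exists_min_rank i j sK s'K.
  have /IZ : I (N t).
    rewrite IE; exists t; last exact: borel_orbit_refl.
    by split=> //; apply: involutive_involutions.
  rewrite /Z /= tij; case E : (involution_rank_mx F t i j) => [//|k] [_].
  by rewrite -[rank_mx _ _ _]/(involution_rank_mx F t i j) E ltnn.
move: (Ix); rewrite IE => -[t [tT ts] tx]; exists t => //.
apply/matrixP => i j; apply/eqP; rewrite eqn_leq ts /=.
by rewrite -(rank_mx_involution_orbit tx).
Qed.
End OrbitClosure.

Theorem theorem3p15 (R : realType) (n : nat) (n_ge1 : (1 <= n)%N)
    (s s' : 'S_n) (hs : involutions s) (hs' : involutions s') :
  let C : fieldType := R[i] in
  let I := zariski_closure (borel_orbit (involution_mx C s)) `&`
           zariski_closure (borel_orbit (involution_mx C s')) in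
  let T : set 'S_n := [set t | involutions t /\
             le_natmx (involution_rank_mx C t) (min_rank_mx C s s')] in
  [/\ I = \bigcup_(t in T) borel_orbit (involution_mx C t),
      trivIset T (fun t => borel_orbit (involution_mx C t)) &
      zariski_irreducible I <->
        involution_rank_mxs C (min_rank_mx C s s')].
Proof. exact: (@closure_intersection R[i] n s s' hs hs'). Qed.
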